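(* Let $F$ be a probability distribution on $\mathbb{Z}_{\ge 0}^3$ with point probabilities $p_{\underline{d}}$, and let $\underline{D}=(D^{\leftarrow},D^{\rightarrow},D^{\leftrightarrow})$ be a random vector with distribution $F$. Write $\mu^{\leftarrow}=\mathrm{E}[D^{\leftarrow}]$, $\mu^{\rightarrow}=\mathrm{E}[D^{\rightarrow}]$, $\mu^{\leftrightarrow}=\mathrm{E}[D^{\leftrightarrow}]$. For each $n$, consider the simple partially directed configuration model graph on $n$ vertices constructed from $F$, let $N_{\underline{d}}^{(n)}$ be the number of its vertices with degree $\underline{d}$, and let $F^{(n)}$ be the distribution with point probabilities $p_{\underline{d}}^{(n)}=\mathrm{E}[N_{\underline{d}}^{(n)}/n]$. If $\mu^{\leftarrow}<\infty$, $\mu^{\rightarrow}<\infty$, $\mu^{\leftrightarrow}<\infty$ and $\mu^{\leftarrow}=\mu^{\rightarrow}$, then, as $n\to\infty$: (a) $F^{(n)}\to F$, i.e. $p_{\underline{d}}^{(n)}\to p_{\underline{d}}$ for every $\underline{d}\in\mathbb{Z}_{\ge 0}^3$; (b) $N_{\underline{d}}^{(n)}/n\to p_{\underline{d}}$ in probability for every $\underline{d}\in\mathbb{Z}_{\ge 0}^3$ (that is, the empirical degree distribution converges in probability to $F$).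
   Context: A partially directed graph may contain both directed and undirected edges. The degree of a vertex is the triple $\underline{d}=(d^{\leftarrow},d^{\rightarrow},d^{\leftrightarrow})$ of its numbers of incoming, outgoing and undirected edges (or, before connection, stubs). A stub is a not-yet-connected half-edge of a vertex; stubs are in-stubs, out-stubs or undirected stubs. A graph is simple if it has no unconnected stubs, no self-loops and no parallel edges (of any type). The (simple) partially directed configuration model graph on $n$ vertices with joint degree distribution $F$ on $\mathbb{Z}_{\ge 0}^3$ (the three components are not assumed independent) is constructed as follows. 1. Start with $n$ vertices without edges or stubs. 2. For each vertex $r=1,\dots,n$ independently draw a degree $\underline{D}_r=(D_r^{\leftarrow},D_r^{\rightarrow},D_r^{\leftrightarrow})$ from $F$, and give vertex $r$ that many in-stubs, out-stubs and undirected stubs. 3. Pick two undirected stubs uniformly at random and connect them to form an undirected edge; repeat with the remaining unconnected undirected stubs until at most one undirected stub is left. 4. Pick one in-stub and one out-stub, independently and uniformly at random, and connect them to form a directed edge (from the vertex of the out-stub to the vertex of the in-stub); repeat with the remaining unconnected directed stubs until there are no in-stubs left or no out-stubs left (or both). 5. Make the graph simple, in this order: (a) erase all unconnected stubs; (b) erase all self-loops, directed and undirected; (c) among parallel identical edges (same endpoints, same type and, if directed, same direction) erase all except one; (d) erase all directed edges that are parallel to an undirected edge; (e) erase each pair of reciprocal directed edges (two directed edges between the same two vertices in opposite directions) and add a single undirected edge between these vertices instead. $N_{\underline{d}}^{(n)}$ counts vertices whose degree in the final simple graph equals $\underline{d}$. *)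

(* Defs.v *)
From HB Require Import structures.
From mathcomp Require Import all_boot all_order all_algebra.
From mathcomp Require Import all_classical all_reals all_analysis.

Set Implicit Arguments.
Unset Strict Implicit.
Unset Printing Implicit Defensive.

Import Order.TTheory GRing.Theory Num.Theory.
Import numFieldNormedType.Exports.

Local Open Scope classical_set_scope.
Local Open Scope ring_scope.

(** A degree is the triple (in-degree, out-degree, undirected degree). *)
Definition degree := (nat * nat * nat)%type.
Definition deg_in (d : degree) : nat := d.1.1.
Definition deg_out (d : degree) : nat := d.1.2.
Definition deg_und (d : degree) : nat := d.2.

Lemma measurable_degree (A : set degree) : measurable A.
Proof.
apply: countable_measurable; last exact: countableP.
move=> [[a b] c].
rewrite (_ : [set (a, b, c)] = ([set a] `*` [set b]) `*` [set c]).
  by apply: measurableX => //; exact: measurableX.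
by apply/seteqP; split=> -[[x y] z] /= => [[-> -> ->]//|[[-> ->] ->]].
Qed.

(** A stub is labelled by its vertex and by its rank among the stubs of the
    same kind at that vertex, so that distinct stubs are distinct objects. *)
Definition stub (n : nat) := ('I_n * nat)%type.

(** Partially directed multigraphs on the vertices 0, ..., n-1, possibly with
    unconnected stubs.  Lists are used as multisets.  A directed edge (u, v)
    goes from u to v; an undirected edge is the set of its endpoints, hence a
    singleton for a self-loop. *)
Record pdgraph (n : nat) := PDGraph {
  in_stubs : seq (stub n) ;
  out_stubs : seq (stub n) ;
  und_stubs : seq (stub n) ;
  dir_edges : seq ('I_n * 'I_n) ;
  und_edges : seq {set 'I_n} }.

Definition empty_graph (n : nat) : pdgraph n :=
  PDGraph [::] [::] [::] [::] [::].

HB.instance Definition _ n := gen_eqMixin (pdgraph n).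
HB.instance Definition _ n := gen_choiceMixin (pdgraph n).
HB.instance Definition _ n := isPointed.Build (pdgraph n) (empty_graph n).
HB.instance Definition _ n := @isMeasurable.Build default_measure_display
  (pdgraph n) discrete_measurable discrete_measurable0
  discrete_measurableC discrete_measurableU.

Lemma measurable_pdgraph n (A : set (pdgraph n)) : measurable A.
Proof. by []. Qed.

Section laws.
Context d (T : measurableType d) d' (U : measurableType d') (R : realType).
Local Open Scope ereal_scope.

(** Law of the outcome of a two-stage experiment: draw x from P, then draw
    from k x.  Every map out of T has to be measurable, which is what [hT]
    guarantees. *)
Definition then_law (hT : forall A : set T, measurable A)
    (P : probability T R) (k : T -> probability U R) : set U -> \bar R :=
  fun A => \int[P]_x k x A.

Section then_law.
Variables (hT : forall A : set T, measurable A).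
Variables (P : probability T R) (k : T -> probability U R).

Let then_law0 : then_law hT P k set0 = 0.
Proof. by apply: integral0_eq => x _; exact: measure0. Qed.

Let then_law_ge0 A : 0 <= then_law hT P k A.
Proof. by apply: integral_ge0 => x _; exact: measure_ge0. Qed.

Let then_law_sigma_additive : semi_sigma_additive (then_law hT P k).
Proof.
move=> A mA tA mUA.
rewrite [X in _ --> X](_ : _ = \sum_(0 <= i <oo) then_law hT P k (A i)).
  by apply: is_cvg_nneseries => i _ _; exact: then_law_ge0.
rewrite -integral_nneseries//; last by move=> i mD Y mY; exact: hT.
by apply: eq_integral => x _; rewrite measure_semi_bigcup.
Qed.

HB.instance Definition _ := isMeasure.Build _ _ _ (then_law hT P k)
  then_law0 then_law_ge0 then_law_sigma_additive.

Let then_law_setT : then_law hT P k setT = 1.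
Proof.
transitivity (\int[P]_x (cst 1) x).
  by apply: eq_integral => x _; exact: probability_setT.
rewrite integral_cst// mul1e; exact: probability_setT.
Qed.

HB.instance Definition _ := Measure_isProbability.Build _ _ _
  (then_law hT P k) then_law_setT.
End then_law.

(** Law of the outcome when x is picked uniformly at random from the nonempty
    list s and the experiment continues with k x (arbitrary if s is empty). *)
Definition pick_law (I : Type) (s : seq I) (k : I -> probability U R) :
    set U -> \bar R :=
  fun A => if s is [::] then \d_point A
           else ((size s)%:R^-1)%:E * \sum_(x <- s) k x A.

Section pick_law.
Variables (I : Type) (s : seq I) (k : I -> probability U R).

Let pick_law0 : pick_law s k set0 = 0.
Proof.
rewrite /pick_law; case: s => [|x0 s']; first exact: measure0.
by rewrite big1 ?mule0// => x _; exact: measure0.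
Qed.

Let pick_law_ge0 A : 0 <= pick_law s k A.
Proof.
rewrite /pick_law; case: s => [|x0 s']; first exact: measure_ge0.
by apply: mule_ge0; [rewrite lee_fin invr_ge0|exact: sume_ge0].
Qed.

Let pick_law_sigma_additive : semi_sigma_additive (pick_law s k).
Proof.
rewrite /pick_law; case: s => [|x0 s'] A mA tA mUA.
  exact: (@measure_semi_sigma_additive _ _ _ (\d_point)).
set t := x0 :: s'.
have r0 : (0 <= (size t)%:R^-1 :> R)%R by rewrite invr_ge0.
rewrite [X in X @ _ --> _](_ : _ = fun m => ((size t)%:R^-1)%:E *
    \sum_(x <- t) \sum_(0 <= i < m) k x (A i)); last first.
  apply/funext => m; rewrite exchange_big/= ge0_sume_distrr// => i _.
  exact: sume_ge0.
apply: cvgeZl => //; elim: t {r0} => [|x t IH].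
  rewrite big_nil; under eq_fun do rewrite big_nil; exact: cvg_cst.
rewrite big_cons; under eq_fun do rewrite big_cons.
apply: cvgeD => //; last exact: measure_semi_sigma_additive.
by apply: ge0_adde_def; rewrite inE; [exact: measure_ge0|exact: sume_ge0].
Qed.

HB.instance Definition _ := isMeasure.Build _ _ _ (pick_law s k)
  pick_law0 pick_law_ge0 pick_law_sigma_additive.

Let pick_law_setT : pick_law s k setT = 1.
Proof.
rewrite /pick_law; case: s => [|x0 s']; first exact: probability_setT.
rewrite (eq_bigr (fun=> 1)) => [|x _]; last exact: probability_setT.
by rewrite sumEFin big_const_seq count_predT iter_addr_0 -EFinM mulVf// pnatr_eq0.
Qed.

HB.instance Definition _ := Measure_isProbability.Build _ _ _
  (pick_law s k) pick_law_setT.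
End pick_law.
End laws.

Section model.
Context (R : realType) (n : nat).
Implicit Types (G : pdgraph n) (r v : 'I_n) (x y : stub n).

Definition graph_law := probability (pdgraph n) R.

Definition ret (G : pdgraph n) : graph_law := (\d_G)%R.

Definition bind (P : graph_law) (k : pdgraph n -> graph_law) : graph_law :=
  then_law (@measurable_pdgraph n) P k.

Definition draw_degree (F : probability degree R) (k : degree -> graph_law) :
  graph_law := then_law measurable_degree F k.

Definition pick (s : seq (stub n)) (k : stub n -> graph_law) : graph_law :=
  pick_law s k.

Fixpoint iterate (m : nat) (step : pdgraph n -> graph_law) (G : pdgraph n) :
    graph_law :=
  if m is m'.+1 then bind (step G) (iterate m' step) else ret G.

Definition new_stubs (r : 'I_n) (m : nat) : seq (stub n) :=
  [seq (r, i) | i <- iota 0 m].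

Definition add_stubs (r : 'I_n) (d : degree) G : pdgraph n :=
  PDGraph (in_stubs G ++ new_stubs r (deg_in d))
          (out_stubs G ++ new_stubs r (deg_out d))
          (und_stubs G ++ new_stubs r (deg_und d))
          (dir_edges G) (und_edges G).

(** Each vertex of the list draws its degree afresh from F, independently of
    the others, and receives the corresponding stubs. *)
Fixpoint attach_stubs (F : probability degree R) (vs : seq 'I_n) G :
    graph_law :=
  if vs is r :: vs' then
    draw_degree F (fun d => attach_stubs F vs' (add_stubs r d G))
  else ret G.

Definition endpoints (e : 'I_n * 'I_n) : {set 'I_n} := [set e.1; e.2]%SET.

Definition join_und x y G : pdgraph n :=
  PDGraph (in_stubs G) (out_stubs G) (rem y (rem x (und_stubs G)))
          (dir_edges G) (endpoints (x.1, y.1) :: und_edges G).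

(** x is the in-stub and y the out-stub. *)
Definition join_dir x y G : pdgraph n :=
  PDGraph (rem x (in_stubs G)) (rem y (out_stubs G)) (und_stubs G)
          ((y.1, x.1) :: dir_edges G) (und_edges G).

Definition connect_und_step G : graph_law :=
  if (size (und_stubs G) <= 1)%N then ret G
  else pick (und_stubs G) (fun x =>
       pick (rem x (und_stubs G)) (fun y => ret (join_und x y G))).

Definition connect_dir_step G : graph_law :=
  if (size (in_stubs G) == 0%N) || (size (out_stubs G) == 0%N) then ret G
  else pick (in_stubs G) (fun x =>
       pick (out_stubs G) (fun y => ret (join_dir x y G))).

(** A step that can still connect something uses up at least one undirected
    (resp. in-) stub and the other steps do nothing, so as many steps as there
    are such stubs exhaust the procedure. *)
Definition connect_und G : graph_law :=
  iterate (size (und_stubs G)) connect_und_step G.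

Definition connect_dir G : graph_law :=
  iterate (size (in_stubs G)) connect_dir_step G.

Definition erase_stubs G : pdgraph n :=
  PDGraph [::] [::] [::] (dir_edges G) (und_edges G).

Definition erase_loops G : pdgraph n :=
  PDGraph (in_stubs G) (out_stubs G) (und_stubs G)
          [seq e <- dir_edges G | e.1 != e.2]
          [seq e : {set 'I_n} <- und_edges G | #|e| != 1%N].

Definition merge_parallel G : pdgraph n :=
  PDGraph (in_stubs G) (out_stubs G) (und_stubs G)
          (undup (dir_edges G)) (undup (und_edges G)).

Definition erase_dir_parallel_und G : pdgraph n :=
  PDGraph (in_stubs G) (out_stubs G) (und_stubs G)
          [seq e <- dir_edges G | endpoints e \notin und_edges G]
          (und_edges G).

(** Both edges of a reciprocal pair yield the same set of endpoints: [undup]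
    keeps a single undirected edge per pair. *)
Definition merge_reciprocal G : pdgraph n :=
  PDGraph (in_stubs G) (out_stubs G) (und_stubs G)
          [seq e <- dir_edges G | (e.2, e.1) \notin dir_edges G]
          (und_edges G ++
           undup [seq endpoints e
                 | e <- dir_edges G & (e.2, e.1) \in dir_edges G]).

Definition make_simple G : pdgraph n :=
  merge_reciprocal (erase_dir_parallel_und (merge_parallel
    (erase_loops (erase_stubs G)))).

(** Law of the simple partially directed configuration model graph. *)
Definition config_model (F : probability degree R) : graph_law :=
  bind (attach_stubs F (enum 'I_n) (empty_graph n)) (fun G0 =>
  bind (connect_und G0) (fun G1 =>
  bind (connect_dir G1) (fun G2 =>
  ret (make_simple G2)))).

(** Only meant for graphs without unconnected stubs and self-loops. *)
Definition vertex_degree G (v : 'I_n) : degree :=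
  (count (fun e => e.2 == v) (dir_edges G),
   count (fun e => e.1 == v) (dir_edges G),
   count (fun e : {set 'I_n} => v \in e) (und_edges G)).

Definition num_degree (d : degree) G : nat :=
  #|[set v : 'I_n | vertex_degree G v == d]%SET|.

(** Proportion of vertices of degree d, i.e. N_d / n (0 when n = 0). *)
Definition frac_degree (d : degree) G : R := (num_degree d G)%:R / n%:R.

End model.

Arguments config_model {R} n F.
Arguments frac_degree {R n} d G.

(** X n is a random variable on the probability space (T n, P n). *)
Definition cvg_in_probability (R : realType) (disp : nat -> measure_display)
    (T : forall n, measurableType (disp n)) (P : forall n, probability (T n) R)
    (X : forall n, T n -> R) (c : R) : Prop :=
  forall eps : R, 0 < eps ->
    P n [set w | eps < `|X n w - c|] @[n --> \oo] --> 0%E.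

(** Point probabilities of F and of F^(n). *)
Definition point_prob (R : realType) (F : probability degree R) (d : degree) :
  R := fine (F [set d]).

Definition mean_frac (R : realType) (F : probability degree R) (n : nat)
  (d : degree) : R := fine ('E_(config_model n F)[frac_degree d])%E.

(* Main.v *)
Require Import Defs.
From HB Require Import structures.
From mathcomp Require Import finmap all_boot all_order all_algebra.
From mathcomp Require Import all_classical all_reals all_analysis.
From mathcomp Require Import measurable_realfun.
From mathcomp Require Import ring lra zify.

(** A vertex keeps the degree it drew unless one of its stubs stays unconnected
or one of its edges is a loop or shares its pair of endpoints with another edge.
So N_d differs from the number of vertices that drew the degree d by at most
the number of vertices touched by such an accident, and the latter number is
o(n) in mean although only first moments are finite.

Accidents are counted while the stubs are being connected.  Fix a threshold K
and call a vertex heavy if it drew more than K stubs in total.  An accident at a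
heavy vertex is paid for by the stub of that vertex that is used up.  If both
vertices are light, the second stub of the new edge, uniform among the m
available ones, has to belong to the vertex of the first stub or to one of its
at most K light neighbours, which has probability at most K(K+1)/m.  Hence the
[potential], namely twice the number of past accidents and of remaining heavy
stubs, plus 2K(K+1) times harmonic sums up to the numbers of stubs left, plus the
difference between the numbers of in- and out-stubs, is a supermartingale
([connect_und_le], [connect_dir_le]), and at the end it dominates the number of
vertices whose degree was altered ([card_misfits]).  At the start it is at most
a sum over the vertices of terms of small mean, because harmonic sums are
sublinear up to a constant ([harmonic_sum_sublinear]) and the mean of the degree
of a vertex on the event that it is heavy tends to 0 as K grows
([tail_integral]), plus a constant, plus the absolute value of the sum of the
centered variables in-degree minus out-degree.

What remains are two instances of the law of large numbers in mean
([iid_lln], proved by truncation): for in-degree minus out-degree, where the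
equality of the two means is used, and for the indicator of the degree d.
Together they give that N_d / n tends to p_d in mean ([expected_distance]),
which implies both claims.

Expectations under the composite laws of the model are computed as iterated
integrals ([integral_then_law], [integral_pick_law]). *)

Set Implicit Arguments.
Unset Strict Implicit.
Unset Printing Implicit Defensive.
Import Order.TTheory GRing.Theory Num.Theory.
Import numFieldNormedType.Exports.
Local Open Scope classical_set_scope.
Local Open Scope ring_scope.

(** * Integrals under composite laws *)

Section integral_characterization.
Context d (U : measurableType d) (R : realType).
Local Open Scope ereal_scope.
Implicit Types f g : U -> \bar R.
Import HBNNSimple.

Variables (mu : {measure set U -> \bar R}) (L : (U -> \bar R) -> \bar R).
Let nonneg_fun f := (forall x, 0 <= f x) /\ measurable_fun [set: U] f.
Hypothesis L_indic : forall A, measurable A ->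
  L (fun x => (\1_A x)%:E) = mu A.
Hypothesis L_add : forall f g, nonneg_fun f -> nonneg_fun g ->
  L (fun x => f x + g x) = L f + L g.
Hypothesis L_scale : forall (c : R) f, (0 <= c)%R -> nonneg_fun f ->
  L (fun x => c%:E * f x) = c%:E * L f.
Hypothesis L_lim : forall h : (U -> \bar R)^nat,
  (forall n, nonneg_fun (h n)) ->
  (forall x, {homo h ^~ x : m n / (m <= n)%N >-> m <= n}) ->
  L (fun x => limn (h ^~ x)) = limn (fun n => L (h n)).

Let L_nnsfun (f : {nnsfun U >-> R}) :
  L (fun x => (f x)%:E) = \int[mu]_x (f x)%:E.
Proof.
rewrite integralT_nnsfun sintegralE.
under eq_fun do rewrite fimfunE -fsumEFin//.
rewrite [RHS]fsbig_finite//.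
under eq_fun do rewrite fsbig_finite//.
have : forall r, r \in enum_fset (fset_set (range f)) -> (0 <= r)%R.
  move=> r; rewrite -[_ \in _]/(r \in fset_set _) in_fset_set// inE.
  by move=> -[x _ <-].
elim: (enum_fset (fset_set (range f))) => [_|r s IH ge0].
  under eq_fun do rewrite big_nil.
  rewrite big_nil (_ : (fun=> 0) = fun x : U => (\1_set0 x)%:E).
    by rewrite L_indic// measure0.
  by apply/funext => x; rewrite indic0.
have r0 : (0 <= r)%R by apply: ge0; rewrite mem_head.
have indic_nonneg (q : R) : nonneg_fun (fun x => (\1_(f @^-1` [set q]) x)%:E).
  by split=> [x|]; [rewrite lee_fin|exact/measurable_EFinP].
under eq_fun do rewrite big_cons EFinM.
rewrite big_cons L_add ?L_scale ?L_indic ?IH//.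
- by move=> q qs; apply: ge0; rewrite inE qs orbT.
- split=> [x|]; first by rewrite mule_ge0.
  apply: measurable_funeM; exact: (indic_nonneg r).2.
- split=> [x|].
    rewrite big_seq; apply: sume_ge0 => q qs.
    by rewrite lee_fin mulr_ge0// ge0// inE qs orbT.
  apply: emeasurable_sum => q; under eq_fun do rewrite EFinM.
  apply: measurable_funeM; exact: (indic_nonneg q).2.
Qed.

(** Simple functions approximate every measurable nonnegative function from
below, so the integral is the only functional that is additive, positively
homogeneous, continuous along monotone limits and right on indicators.  This
reduces the integral under a composite law to its values on sets. *)
Lemma integral_characterization f : (forall x, 0 <= f x) ->
  measurable_fun setT f -> \int[mu]_x f x = L f.
Proof.
move=> f0 mf; pose h := nnsfun_approx measurableT mf.
have hh x : {homo (fun n => (h n x)%:E) : m n / (m <= n)%N >-> m <= n}.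
  by move=> a b ab; rewrite lee_fin; exact/lefP/nd_nnsfun_approx.
have fE : f = fun x => limn (fun n => (h n x)%:E).
  by apply/funext => x; apply/esym/cvg_lim => //; exact: cvg_nnsfun_approx.
rewrite [in RHS]fE L_lim//; last first.
  move=> n; split=> [x|]; first by rewrite lee_fin.
  exact/measurable_EFinP.
under [in RHS]eq_fun do rewrite L_nnsfun.
rewrite fE monotone_convergence//.
- by move=> n; exact/measurable_EFinP.
- by move=> n x _; rewrite lee_fin.
Qed.

End integral_characterization.

Section composite_laws.
Context d (T : measurableType d) d' (U : measurableType d') (R : realType).
Local Open Scope ereal_scope.

Lemma discrete_measurable_fun d1 (V : measurableType d1) (f : T -> V) :
  (forall A : set T, measurable A) -> measurable_fun [set: T] f.
Proof. by move=> mT _ A mA; exact: mT. Qed.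

Lemma integral_then_law (hT : forall A : set T, measurable A)
    (P : probability T R) (k : T -> probability U R) (f : U -> \bar R) :
  (forall x, 0 <= f x) -> measurable_fun [set: U] f ->
  \int[then_law hT P k]_y f y = \int[P]_x \int[k x]_y f y.
Proof.
move=> f0 mf.
apply: (integral_characterization
  (L := fun f => \int[P]_x \int[k x]_y f y)) => //.
- by move=> A mA; apply: eq_integral => x _; rewrite integral_indic// setIT.
- move=> g h [g0 mg] [h0 mh].
  under eq_integral do rewrite ge0_integralD//.
  rewrite ge0_integralD//; first [exact: discrete_measurable_fun |
    by move=> x _; exact: integral_ge0].
- move=> c g c0 [g0 mg].
  under eq_integral do rewrite ge0_integralZl//.
  rewrite ge0_integralZl//; first [exact: discrete_measurable_fun |
    by move=> x _; exact: integral_ge0].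
- move=> h h0 ndh.
  have limE x : \int[k x]_y limn (h ^~ y) = limn (fun n => \int[k x]_y h n y).
    rewrite monotone_convergence//.
    + by move=> n; exact: (h0 n).2.
    + by move=> n y _; exact: (h0 n).1.
  under eq_integral do rewrite limE.
  rewrite monotone_convergence//.
  + by move=> n; exact: discrete_measurable_fun.
  + by move=> n x _; apply: integral_ge0 => y _; exact: (h0 n).1.
  + move=> x _ a b ab; apply: ge0_le_integral => //.
    * by move=> y _; exact: (h0 a).1.
    * exact: (h0 a).2.
    * exact: (h0 b).2.
    * by move=> y _; exact: ndh.
Qed.

Lemma integral_pick_law (I : Type) (s : seq I) (k : I -> probability U R)
    (f : U -> \bar R) : (0 < size s)%N ->
  (forall x, 0 <= f x) -> measurable_fun [set: U] f ->
  \int[pick_law s k]_y f y =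
  ((size s)%:R^-1)%:E * \sum_(x <- s) \int[k x]_y f y.
Proof.
move=> s_gt0 f0 mf.
have r0 : (0 <= (size s)%:R^-1 :> R)%R by rewrite invr_ge0.
have i0 g x : (forall y, 0 <= g y) -> 0 <= \int[k x]_y g y.
  by move=> g0; exact: integral_ge0.
apply: (integral_characterization
  (L := fun f => ((size s)%:R^-1)%:E * \sum_(x <- s) \int[k x]_y f y)) => //.
- move=> A mA; rewrite /= /pick_law; case: (s) s_gt0 => // x0 s' _.
  by congr (_ * _); apply: eq_bigr => x _; rewrite integral_indic// setIT.
- move=> g h [g0 mg] [h0 mh].
  under eq_bigr do rewrite ge0_integralD//.
  by rewrite big_split/= ge0_muleDr// ; apply: sume_ge0 => x _; exact: i0.
- move=> c g c0 [g0 mg].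
  under eq_bigr do rewrite ge0_integralZl//.
  rewrite -ge0_sume_distrr; last by move=> x _; exact: i0.
  by rewrite muleCA.
- move=> h h0 ndh.
  have hn0 n x : 0 <= \int[k x]_y h n y by apply: i0; exact: (h0 n).1.
  have ndi x : {homo (fun n => \int[k x]_y h n y) : m n / (m <= n)%N >-> m <= n}.
    move=> a b ab; apply: ge0_le_integral => //.
    + by move=> y _; exact: (h0 a).1.
    + exact: (h0 a).2.
    + exact: (h0 b).2.
    + by move=> y _; exact: ndh.
  apply/esym/cvg_lim => //; apply: cvgeZl => //.
  elim: (s) => [|x t IH].
    by rewrite big_nil; under eq_fun do rewrite big_nil; exact: cvg_cst.
  rewrite big_cons; under eq_fun do rewrite big_cons.
  apply: cvgeD => //.
    apply: ge0_adde_def; rewrite inE ?sume_ge0//.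
      by apply: i0 => y; apply: lime_ge; [exact: ereal_nondecreasing_is_cvgn
        |apply: nearW => n; exact: (h0 n).1].
    move=> z _; apply: i0 => y; apply: lime_ge; [exact: ereal_nondecreasing_is_cvgn
        |apply: nearW => n; exact: (h0 n).1].
  rewrite monotone_convergence//.
  + exact: ereal_nondecreasing_is_cvgn.
  + by move=> n; exact: (h0 n).2.
  + by move=> n y _; exact: (h0 n).1.
Qed.

End composite_laws.

(** * Raw degrees, links and collisions *)

Section raw_degree.
Variable n : nat.
Implicit Types (G : pdgraph n) (v u : 'I_n) (s : seq (stub n)).
Implicit Types (x y : stub n) (l : seq {set 'I_n}).
Local Open Scope nat_scope.

Lemma count_rem_mem (T : eqType) (a : pred T) (x : T) (s : seq T) :
  x \in s -> count a s = a x + count a (rem x s).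
Proof. by move=> /perm_to_rem /permP ->. Qed.

Definition stubs_at v s := count (fun x => x.1 == v) s.

(** The degree of v in the unfinished multigraph, unconnected stubs included.
The summand (e == [set v]) counts an undirected loop a second time, which makes
the raw degree invariant under every connection. *)
Definition raw_degree G v : degree :=
  (stubs_at v (in_stubs G) + count (fun e : 'I_n * 'I_n => e.2 == v) (dir_edges G),
   stubs_at v (out_stubs G) + count (fun e : 'I_n * 'I_n => e.1 == v) (dir_edges G),
   stubs_at v (und_stubs G) +
     \sum_(e <- und_edges G) ((v \in e) + (e == [set v]%SET))).

Definition degree_size (d : degree) := deg_in d + deg_out d + deg_und d.

(** Directed and undirected edges are treated alike, since an edge may be erased
or replaced because of an edge of the other kind or of the other direction
between the same two vertices. *)
Definition links G : seq {set 'I_n} :=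
  map (@endpoints n) (dir_edges G) ++ und_edges G.

Lemma set2_eq1 (T : finType) (a b v : T) :
  ([set a; b] == [set v])%SET = (a == v) && (b == v).
Proof.
apply/eqP/andP => [E|[/eqP-> /eqP->]]; last by rewrite finset.setUid.
have memE w : (w == v) = (w \in [set a; b]%SET) by rewrite E finset.in_set1.
by rewrite !memE finset.set21 finset.set22.
Qed.

Lemma endpoint_incidences v u w :
  (v \in [set u; w]%SET) + ([set u; w] == [set v])%SET = (u == v) + (w == v).
Proof.
rewrite set2_eq1 !inE ![v == _]eq_sym.
by case: (u == v); case: (w == v).
Qed.

Lemma raw_degree_join_und x y G :
  x \in und_stubs G -> y \in rem x (und_stubs G) ->
  raw_degree (join_und x y G) =1 raw_degree G.
Proof.
move=> xG yG v; rewrite /raw_degree /=; congr (_, _, _).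
rewrite big_cons /endpoints endpoint_incidences /stubs_at.
rewrite (count_rem_mem _ xG) (count_rem_mem _ yG) /=.
by rewrite !addnA; congr (_ + _); rewrite -addnA addnC.
Qed.

Lemma raw_degree_join_dir x y G :
  x \in in_stubs G -> y \in out_stubs G ->
  raw_degree (join_dir x y G) =1 raw_degree G.
Proof.
move=> xG yG v; rewrite /raw_degree /stubs_at /=; congr (_, _, _).
  by rewrite (count_rem_mem _ xG) /= addnCA addnA.
by rewrite (count_rem_mem _ yG) /= addnCA addnA.
Qed.

(** A lower bound only: a directed loop contributes twice to the raw degree but
once to the links through v. *)
Lemma raw_degree_size_ge G v :
  stubs_at v (in_stubs G) + stubs_at v (out_stubs G) + stubs_at v (und_stubs G)
    + count (fun e : {set 'I_n} => v \in e) (links G)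
  <= degree_size (raw_degree G v).
Proof.
rewrite /degree_size /raw_degree /deg_in /deg_out /deg_und /= /links count_cat.
rewrite count_map.
have dirle :
    count (preim (@endpoints n) (fun e : {set 'I_n} => v \in e)) (dir_edges G) <=
    count (fun e : 'I_n * 'I_n => e.1 == v) (dir_edges G) +
    count (fun e : 'I_n * 'I_n => e.2 == v) (dir_edges G).
  rewrite -count_predUI; apply: leq_trans (leq_addr _ _).
  by apply: sub_count => e /=; rewrite !inE ![v == _]eq_sym.
have undle : count (fun e : {set 'I_n} => v \in e) (und_edges G) <=
    \sum_(e <- und_edges G) ((v \in e) + (e == [set v]%SET)).
  by rewrite -sum1_count big_mkcond; apply: leq_sum => e _; case: (v \in e).
have arith (a b c p q x y z : nat) : p <= x + y -> q <= z ->
  a + b + c + (p + q) <= a + y + (b + x) + (c + z) by lia.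
exact: arith dirle undle.
Qed.

(** Edges are prepended as they are created, so this counts the edges that are
loops or parallel to an earlier edge at the time of their creation. *)
Fixpoint collisions l : nat :=
  if l is e :: l' then ((#|e| == 1) || (e \in l')) + collisions l' else 0.

Definition in_collision l v :=
  has (fun e : {set 'I_n} => (v \in e) && ((#|e| == 1) || (1 < count_mem e l))) l.

(** A pair of endpoints that is a loop or occurs several times accounts for at
least one collision and touches at most two vertices. *)
Lemma card_in_collision l : all (fun e : {set 'I_n} => #|e| <= 2) l ->
  #|[set v | in_collision l v]%SET| <= 2 * collisions l.
Proof.
elim: l => [_|e l IH /= /andP[e2 l2]].
  by rewrite (_ : finset _ = finset.set0) ?cards0//; apply/setP => v; rewrite !inE.
rewrite mulnDr; have {IH}/= := IH l2.
set c := (_ || _); set U := finset _ => Ul.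
have sub : [set v | in_collision (e :: l) v]%SET \subset
    ((if c then e else finset.set0) :|: U)%SET.
  apply/fintype.subsetP => v; rewrite !inE => /hasP[f fl /andP[vf fbad]].
  have [fe|fe] := eqVneq f e.
    move: fbad; rewrite fe /= eqxx add1n ltnS -has_count has_pred1.
    by rewrite -/c => ->; rewrite -fe vf.
  apply/orP; right; apply/hasP; exists f.
    by move: fl; rewrite inE (negPf fe).
  by move: fbad; rewrite vf /= (eq_sym e) (negPf fe).
apply: (leq_trans (subset_leq_card sub)).
apply: (leq_trans (leq_card_setU _ _)).
by apply: leq_add Ul; case: (c); rewrite ?cards0 ?muln1.
Qed.

Lemma count_undup_id (T : eqType) (a : pred T) (s : seq T) :
  (forall x : T, x \in s -> a x -> count_mem x s <= 1) ->
  count a (undup s) = count a s.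
Proof.
move=> H; rewrite -!size_filter filter_undup undup_id//.
apply: count_mem_uniq => x; rewrite mem_filter.
case: (boolP (a x)) => ax /=; last first.
  by apply/count_memPn; rewrite mem_filter negb_and ax.
rewrite count_filter (eq_count (a2 := pred1 x)); last first.
  by move=> z /=; case: eqVneq => // ->; rewrite ax.
case: (boolP (x \in s)) => xs; last by apply/count_memPn.
by apply/eqP; rewrite eqn_leq H//= -has_count has_pred1.
Qed.

Lemma count_gt1 (T : eqType) (a : pred T) (x y : T) (s : seq T) :
  x \in s -> y \in s -> x != y -> a x -> a y -> 1 < count a s.
Proof.
move=> xs ys xy ax ay; rewrite (count_rem_mem _ xs) ax add1n ltnS.
rewrite -has_count; apply/hasP; exists y => //.
have := perm_mem (perm_to_rem xs) y; rewrite ys inE eq_sym (negPf xy) /= => <-.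
by [].
Qed.

Lemma endpoints_swap (a b : 'I_n) : endpoints (a, b) = endpoints (b, a).
Proof. by rewrite /endpoints finset.setUC. Qed.

(** Away from unconnected stubs and collisions none of the simplification rules
applies: the edges at v are no loops, occur once, and have no other edge between
the same endpoints, in particular no reciprocal one. *)
Lemma vertex_degree_make_simple G v :
  stubs_at v (in_stubs G) = 0 -> stubs_at v (out_stubs G) = 0 ->
  stubs_at v (und_stubs G) = 0 -> ~~ in_collision (links G) v ->
  vertex_degree (make_simple G) v = raw_degree G v.
Proof.
move=> in0 out0 und0 /hasPn clean.
rewrite /raw_degree in0 out0 und0 !add0n.
have linkP (e : {set 'I_n}) : e \in links G -> v \in e ->
    #|e| != 1 /\ count_mem e (links G) <= 1.
  by move=> /clean + ve; rewrite ve /= negb_or -leqNgt => /andP.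
have dirP (e : 'I_n * 'I_n) : e \in dir_edges G -> v \in endpoints e ->
    [/\ e.1 != e.2, count_mem e (dir_edges G) <= 1,
        endpoints e \notin und_edges G & (e.2, e.1) \notin dir_edges G].
  move=> eG ve; have el : endpoints e \in links G.
    by rewrite mem_cat map_f.
  have [e1 ce] := linkP _ el ve; have ne : e.1 != e.2.
    by apply: contra e1 => /eqP e12; rewrite /endpoints e12 finset.setUid cards1.
  move: ce; rewrite /links count_cat count_map => ce.
  split=> //.
  - apply: leq_trans ce; apply: leq_trans (leq_addr _ _).
    by apply: sub_count => f /= /eqP ->.
  - apply/negP => eu.
    have c1 : 0 < count_mem (endpoints e) (und_edges G).
      by rewrite -has_count has_pred1.
    have c2 : 0 < count (preim (@endpoints n) (pred1 (endpoints e))) (dir_edges G).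
      by rewrite -has_count; apply/hasP; exists e => //=.
    by move: (leq_trans (leq_add c2 c1) ce).
  - apply/negP => er.
    have : 1 < count (preim (@endpoints n) (pred1 (endpoints e))) (dir_edges G).
      apply: (count_gt1 eG er) => //=; last by rewrite endpoints_swap; case: (e).
      by case: (e) ne => a b /= ab; rewrite xpair_eqE negb_and ab.
    by rewrite ltnNge (leq_trans (leq_addr _ _) ce).
have undP (e : {set 'I_n}) : e \in und_edges G -> v \in e ->
    #|e| != 1 /\ count_mem e (und_edges G) <= 1.
  move=> eG ve; have el : e \in links G by rewrite mem_cat eG orbT.
  have [e1 ce] := linkP _ el ve; split=> //; apply: leq_trans ce.
  by rewrite /links count_cat leq_addl.
have simple_dir (a : pred ('I_n * 'I_n)) :
    (forall e, a e -> v \in endpoints e) ->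
    count a (dir_edges (make_simple G)) = count a (dir_edges G).
  move=> av; rewrite /make_simple /=.
  rewrite !count_filter.
  transitivity (count a [seq e <- dir_edges G | e.1 != e.2]).
    rewrite -(@count_undup_id _ a); last first.
      move=> e; rewrite mem_filter => /andP[_ eG] ae.
      rewrite count_filter.
      have [_ ce _ _] := dirP _ eG (av _ ae).
      by apply: leq_trans ce; apply: sub_count => f /= /andP[].
    apply: eq_in_count => e; rewrite mem_undup mem_filter => /andP[_ eG] /=.
    case: (boolP (a e)) => //= ae; have [_ _ eu er] := dirP _ eG (av _ ae).
    rewrite mem_undup !mem_filter !mem_undup !mem_filter.
    by rewrite (negPf er) (negPf eu) !andbF.
  rewrite count_filter; apply: eq_in_count => e eG /=.
  case: (boolP (a e)) => //= ae; by have [-> _ _ _] := dirP _ eG (av _ ae).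
rewrite /vertex_degree !simple_dir.
- congr (_, _, _); rewrite /make_simple /= count_cat.
  rewrite [X in _ + X](_ : _ = 0); last first.
    apply/eqP; rewrite -leqn0 leqNgt -has_count; apply/hasPn => f.
    rewrite mem_undup => /mapP[e]; rewrite !mem_filter !mem_undup !mem_filter.
    move=> /andP[/andP[_ /andP[_ rG]] /andP[_ /andP[_ eG]]] ->.
    by apply/negP => ve; have [_ _ _ /negP] := dirP _ eG ve; apply.
  rewrite addn0 count_undup_id; last first.
    move=> e; rewrite mem_filter => /andP[_ eG] ve; rewrite count_filter.
    have [_ ce] := undP _ eG ve.
    by apply: leq_trans ce; apply: sub_count => f /= /andP[].
  rewrite count_filter -sum1_count big_mkcond big_seq [RHS]big_seq.
  apply: eq_bigr => e eG /=; case: (boolP (v \in e)) => ve /=.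
    have [e1 _] := undP _ eG ve; rewrite ifT//.
    by case: eqP => // ev; rewrite ev cards1 in e1.
  by case: eqVneq => // e0; rewrite e0 inE eqxx in ve.
- by move=> e /eqP <-; rewrite !inE eqxx.
- by move=> e /eqP <-; rewrite !inE eqxx orbT.
Qed.

Definition misfits (D : 'I_n -> degree) G : {set 'I_n} :=
  [set v | vertex_degree G v != D v]%SET.

Lemma card_misfits G (D : 'I_n -> degree) : raw_degree G =1 D ->
  all (fun e : {set 'I_n} => #|e| <= 2) (und_edges G) ->
  #|misfits D (make_simple G)| <= 2 * collisions (links G) +
    (size (in_stubs G) + size (out_stubs G) + size (und_stubs G)).
Proof.
move=> GD und2.
have l2 : all (fun e : {set 'I_n} => #|e| <= 2) (links G).
  rewrite all_cat und2 andbT all_map; apply/allP => e _ /=.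
  by rewrite /endpoints cards2; case: eqP.
apply: leq_trans (leq_add (card_in_collision l2) (leqnn _)).
pose S := [seq x.1 | x <- in_stubs G ++ out_stubs G ++ und_stubs G].
have -> : size (in_stubs G) + size (out_stubs G) + size (und_stubs G) = size S.
  by rewrite size_map !size_cat addnA.
apply: leq_trans (leq_add (leqnn _) (card_size S)).
rewrite -[X in _ <= _ + X]cardsE; apply: leq_trans (leq_card_setU _ _).
apply: subset_leq_card; apply/fintype.subsetP => v; rewrite !inE => vD.
apply/negPn/negP; rewrite negb_or => /andP[vc vS].
move/negP: vD; apply; rewrite -GD vertex_degree_make_simple//.
all: apply/eqP; rewrite -leqn0 leqNgt -has_count; apply: contra vS.
all: move=> /hasP[x xG /eqP <-]; apply/mapP; exists x => //.
all: by rewrite !mem_cat xG ?orbT.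
Qed.

(** The distinct pairs that u must not form again are its at most K links and the
loop at u.  Each of them determines the vertex at the other end, which has at
most K stubs if it is light. *)
Lemma collision_count (D : 'I_n -> degree) K u l s :
  degree_size (D u) <= K ->
  count (fun e : {set 'I_n} => u \in e) l <= degree_size (D u) ->
  (forall v, stubs_at v s <= degree_size (D v)) ->
  count (fun y => (degree_size (D y.1) <= K) &&
    ((#|[set u; y.1]%SET| == 1) || ([set u; y.1]%SET \in l))) s <= K.+1 * K.
Proof.
move=> uK ul sD.
pose m := [set u]%SET :: [seq e : {set 'I_n} <- l | u \in e].
pose hit (e : {set 'I_n}) y := (degree_size (D y.1) <= K) && ([set u; y.1]%SET == e).
have hit_le e : count (hit e) s <= K.
  case: (boolP (has (hit e) s)) => [/hasP[z zs /andP[zK /eqP ez]]|].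
    apply: leq_trans zK; apply: leq_trans (sD z.1); apply: sub_count => y.
    move=> /andP[_ /eqP ey]; rewrite -ez in ey; apply/eqP.
    have := finset.set22 u y.1; rewrite ey !inE => /orP[/eqP yu|/eqP//].
    have := finset.set22 u z.1; rewrite -ey !inE => /orP[/eqP zu|/eqP//].
    by rewrite yu zu.
  by rewrite has_count -leqNgt => /leq_trans; apply.
have sub : count (fun y => (degree_size (D y.1) <= K) &&
    ((#|[set u; y.1]%SET| == 1) || ([set u; y.1]%SET \in l))) s <=
    \sum_(e <- m) count (hit e) s.
  under [leqRHS]eq_bigr do rewrite -sum1_count big_mkcond.
  rewrite exchange_big /= -sum1_count big_mkcond; apply: leq_sum => y _.
  case: ifP => // /andP[yK yl]; have : [set u; y.1]%SET \in m.
    rewrite inE mem_filter; case/orP: yl => [c1|->]; last first.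
      by rewrite finset.set21 orbT.
    move: c1; rewrite cards2; case: (eqVneq u y.1) => // <- _.
    by rewrite finset.setUid eqxx.
  move=> ym; rewrite (big_rem _ ym) /= /hit yK eqxx /=; exact: leq_addr.
apply: (leq_trans sub); apply: (@leq_trans (\sum_(e <- m) K)).
  exact: leq_sum.
rewrite big_const_seq count_predT iter_addn_0 mulnC leq_mul2r /= ltnS.
by rewrite size_filter (leq_trans ul) ?orbT.
Qed.

End raw_degree.

(** * One step of the connection procedure *)

Section expectation_steps.
Variables (R : realType) (n : nat).
Implicit Types (G : pdgraph n) (f : pdgraph n -> \bar R).
Local Open Scope ereal_scope.

Lemma measurable_fun_graph f : measurable_fun [set: pdgraph n] f.
Proof. exact: discrete_measurable_fun. Qed.

Lemma integral_bind (P : graph_law R n) (k : pdgraph n -> graph_law R n) f :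
  (forall G, 0 <= f G) -> \int[bind P k]_G f G = \int[P]_H \int[k H]_G f G.
Proof.
by move=> f0; apply: integral_then_law => //; exact: measurable_fun_graph.
Qed.

Lemma integral_ret G f : \int[ret R G]_H f H = f G.
Proof.
by rewrite /ret integral_dirac// ?diracT ?mul1e//; exact: measurable_fun_graph.
Qed.

Lemma ge0_integral_graph (P : graph_law R n) f :
  (forall G, 0 <= f G) -> 0 <= \int[P]_G f G.
Proof. by move=> f0; exact: integral_ge0. Qed.

Lemma le_integral_graph (P : graph_law R n) f g : (forall G, 0 <= f G) ->
  (forall G, f G <= g G) -> \int[P]_G f G <= \int[P]_G g G.
Proof.
by move=> f0 fg; apply: ge0_le_integral.
Qed.

Lemma average_le (I : eqType) (s : seq I) (a : I -> \bar R) (b : I -> R) (B : R) :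
  (0 < size s)%N -> (forall x, x \in s -> a x <= (b x)%:E) ->
  (\sum_(x <- s) b x <= (size s)%:R * B)%R ->
  ((size s)%:R^-1)%:E * \sum_(x <- s) a x <= B%:E.
Proof.
move=> s0 ab bB; have s0' : (0 < (size s)%:R :> R)%R by rewrite ltr0n.
rewrite lee_pdivrMl// -EFinM; apply: (@le_trans _ _ (\sum_(x <- s) (b x)%:E)).
  by rewrite big_seq [leRHS]big_seq; exact: lee_sum.
by rewrite sumEFin lee_fin.
Qed.

Lemma pick_pair_le (s : seq (stub n)) (t : stub n -> seq (stub n))
    (j : stub n -> stub n -> pdgraph n) f (b : stub n -> stub n -> R) (B : R) :
  (0 < size s)%N -> (forall x, x \in s -> (0 < size (t x))%N) ->
  (forall G, 0 <= f G) ->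
  (forall x y, x \in s -> y \in t x -> f (j x y) <= (b x y)%:E) ->
  (forall x, x \in s -> \sum_(y <- t x) b x y <= (size (t x))%:R * B)%R ->
  \int[Defs.pick s (fun x => Defs.pick (t x) (fun y => ret R (j x y)))]_G f G
    <= B%:E.
Proof.
move=> s0 t0 f0 fb bB; have mf := measurable_fun_graph f.
rewrite integral_pick_law//; apply: (average_le (b := fun=> B)) => //; last first.
  by rewrite big_const_seq count_predT iter_addr_0 mulr_natl.
move=> x xs; rewrite integral_pick_law ?t0//.
apply: (average_le (b := b x)) => //; [exact: t0| |exact: bB].
by move=> y yt; rewrite integral_ret; exact: fb.
Qed.

(** Optional stopping for a supermartingale: if no step increases the expected
potential, the final cost is bounded by the initial potential.  The invariant is
indexed by the number of steps left, and the step hypothesis speaks of an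
arbitrary function h because the expected future cost is not explicit. *)
Lemma iterate_le (step : pdgraph n -> graph_law R n)
    (inv : nat -> pdgraph n -> Prop) f (Phi : pdgraph n -> R) :
  (forall G, 0 <= f G) ->
  (forall G, inv 0%N G -> f G <= (Phi G)%:E) ->
  (forall m G h, inv m.+1 G -> (forall H, 0 <= h H) ->
    (forall H, inv m H -> h H <= (Phi H)%:E) ->
    \int[step G]_H h H <= (Phi G)%:E) ->
  forall m G, inv m G -> \int[iterate m step G]_H f H <= (Phi G)%:E.
Proof.
move=> f0 end_le step_le; elim=> [|m IH] G Gm /=.
  by rewrite integral_ret; exact: end_le.
rewrite integral_bind//; apply: step_le Gm _ IH => H.
exact: ge0_integral_graph.
Qed.

End expectation_steps.

(** * The potential of a partially connected graph *)

Section connecting.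
Variables (R : realType) (n : nat) (D : 'I_n -> degree) (K : nat).
Implicit Types (G : pdgraph n) (x y : stub n) (s : seq (stub n)).

Definition harmonic_sum m : R := \sum_(i < m) i.+1%:R^-1.

Lemma harmonic_sumS m : harmonic_sum m.+1 = harmonic_sum m + m.+1%:R^-1.
Proof. by rewrite /harmonic_sum big_ord_recr. Qed.

Lemma harmonic_sum_ge0 m : 0 <= harmonic_sum m.
Proof. by apply: sumr_ge0 => i _; rewrite invr_ge0. Qed.

(** D is meant to be the function of raw degrees, which the connection procedure
leaves unchanged; hence heaviness of a vertex does not change either. *)
Definition heavy x := (K < degree_size (D x.1))%N.

(** A new edge at a heavy vertex removes a heavy stub, so it does not increase the
load even if it is a collision. *)
Definition load G : nat :=
  (collisions (links G) + (count heavy (in_stubs G) + count heavy (out_stubs G)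
    + count heavy (und_stubs G)))%N.

Definition imbalance G : nat :=
  ((size (in_stubs G) - size (out_stubs G)) +
   (size (out_stubs G) - size (in_stubs G)))%N.

(** The harmonic sums are the compensators of light collisions: with m candidate
stubs a light collision has probability at most K(K+1)/m, and one candidate
disappears in the step.  The imbalance bounds the directed stubs that remain
unconnected, and the final 1 the undirected one. *)
Definition potential G : R :=
  2 * (load G)%:R + 2 * (K.+1 * K)%:R *
    (harmonic_sum (size (out_stubs G)) + harmonic_sum (size (und_stubs G))) +
  (imbalance G)%:R + 1.

Definition light_collision G x y : bool :=
  [&& ~~ heavy x, ~~ heavy y &
    (#|[set x.1; y.1]%SET| == 1%N) || ([set x.1; y.1]%SET \in links G)].

Lemma load_join_dir G x y : x \in in_stubs G -> y \in out_stubs G ->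
  (load (join_dir x y G) <= load G + light_collision G x y)%N.
Proof.
move=> xG yG; rewrite /load /light_collision /links /=.
rewrite (count_rem_mem heavy xG) (count_rem_mem heavy yG).
rewrite /endpoints /= finset.setUC -/(links G).
set i := count heavy (rem x _); set o := count heavy (rem y _).
move: (count heavy (und_stubs G)) i o => u i o.
move: (collisions _) (_ || _) => c b.
case: (heavy x); case: (heavy y); case: b => /=; lia.
Qed.

Lemma load_join_und G x y : dir_edges G = [::] ->
  x \in und_stubs G -> y \in rem x (und_stubs G) ->
  (load (join_und x y G) <= load G + light_collision G x y)%N.
Proof.
move=> G0 xG yG; rewrite /load /light_collision /links /= G0 /=.
rewrite (count_rem_mem heavy xG) (count_rem_mem heavy yG).
rewrite /endpoints /=.
set u := count heavy (rem _ _).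
move: (count heavy (in_stubs G)) (count heavy (out_stubs G)) u => i o u.
move: (collisions _) (_ || _) => c b.
case: (heavy x); case: (heavy y); case: b => /=; lia.
Qed.

Lemma light_collision_count G x s : raw_degree G =1 D ->
  (forall v, (stubs_at v s <= degree_size (D v))%N) ->
  (count (light_collision G x) s <= K.+1 * K)%N.
Proof.
move=> GD sD; rewrite /light_collision /heavy -leqNgt.
case: (leqP (degree_size (D x.1)) K) => xK /=; last by rewrite count_pred0.
under eq_count do rewrite -leqNgt.
apply: collision_count => //; rewrite -GD.
by apply: leq_trans (raw_degree_size_ge _ _); exact: leq_addl.
Qed.

Lemma sum_step_le (B : R) (b : pred (stub n)) s :
  (0 < size s)%N -> (count b s <= K.+1 * K)%N ->
  \sum_(y <- s) (B + 2 * (b y)%:R - 2 * (K.+1 * K)%:R * (size s)%:R^-1)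
    <= (size s)%:R * B.
Proof.
move=> s0 bK; have s0' : (size s)%:R != 0 :> R by rewrite pnatr_eq0 -lt0n.
rewrite sumrB big_split /= -mulr_sumr !big_const_seq !count_predT !iter_addr_0.
rewrite -natr_sum.
have -> : (\sum_(y <- s) b y)%N = count b s.
  by rewrite -sum1_count [RHS]big_mkcond; apply: eq_bigr => y _; case: (b y).
rewrite -[_ *+ size s]mulr_natl -[X in _ - X]mulr_natr divfK//.
by rewrite -addrA gerDl subr_le0 ler_pM2l// ler_nat.
Qed.

Let inv_dir m G := [/\ raw_degree G =1 D,
  all (fun e : {set 'I_n} => #|e| <= 2)%N (und_edges G),
  (size (und_stubs G) <= 1)%N &
  (minn (size (in_stubs G)) (size (out_stubs G)) <= m)%N].

Let inv_und m G := [/\ raw_degree G =1 D,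
  all (fun e : {set 'I_n} => #|e| <= 2)%N (und_edges G),
  dir_edges G = [::] & (size (und_stubs G) <= m.+1)%N].

Let nmisfits G : \bar R := (#|misfits D (make_simple G)|%:R)%:E.

(** Both kinds of directed stubs lose one element in each step, so the imbalance is
constant, and it equals the number of leftover directed stubs at the end. *)
Lemma connect_dir_le m G : inv_dir m G ->
  (\int[iterate m (@connect_dir_step R n) G]_H nmisfits H <= (potential G)%:E)%E.
Proof.
apply: (@iterate_le _ _ _ inv_dir) => {m G} [G|G|m G h].
- by rewrite lee_fin.
- move=> [GD und2 und1 io0]; rewrite lee_fin.
  have bnd : (#|misfits D (make_simple G)| <= 2 * load G + imbalance G + 1)%N.
    apply: leq_trans (card_misfits GD und2) _.
    by rewrite /load /imbalance; lia.
  have h0 : 0 <= 2 * (K.+1 * K)%:R *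
     (harmonic_sum (size (out_stubs G)) + harmonic_sum (size (und_stubs G))).
    by rewrite mulr_ge0// addr_ge0// harmonic_sum_ge0.
  have cast (a l i : nat) : (a <= 2 * l + i + 1)%N ->
      a%:R <= 2 * l%:R + i%:R + 1 :> R.
    by rewrite -(ler_nat R) 2!natrD natrM.
  move: (cast _ _ _ bnd); rewrite /potential; lra.
- move=> [GD und2 und1 iom] h0 hPhi; rewrite /connect_dir_step.
  case: ifPn => [io0|].
    by rewrite integral_ret; apply: hPhi; split => //; lia.
  rewrite negb_or -!lt0n => /andP[i0 o0].
  apply: (pick_pair_le (b := fun x y => potential G + 2 * (light_collision G x y)%:R
    - 2 * (K.+1 * K)%:R * (size (out_stubs G))%:R^-1)) => //.
    move=> x y xG yG; apply: le_trans (hPhi _ _) _.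
      split=> //=; first by move=> v; rewrite raw_degree_join_dir.
      have arith (i o : nat) : (0 < i -> 0 < o -> minn i o <= m.+1 ->
        minn i.-1 o.-1 <= m)%N by lia.
      by rewrite !size_rem//; exact: arith.
    rewrite lee_fin /potential.
    have := load_join_dir xG yG; rewrite -(ler_nat R) natrD.
    have -> : imbalance (join_dir x y G) = imbalance G.
      have arith (i o : nat) : (0 < i -> 0 < o ->
        (i.-1 - o.-1) + (o.-1 - i.-1) = (i - o) + (o - i))%N by lia.
      by rewrite /imbalance /= !size_rem//; exact: arith.
    rewrite /= !size_rem// -{2}(prednK o0) harmonic_sumS prednK//.
    set c := _%:R; set d := _^-1; move: (harmonic_sum _) (harmonic_sum _) => p q.
    nra.
  move=> x xG; apply: sum_step_le => //; apply: light_collision_count => // v.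
  rewrite -GD; apply: leq_trans (raw_degree_size_ge _ _).
  by rewrite -!addnA addnCA leq_addr.
Qed.

(** A step uses up two undirected stubs, and only the second one is picked among
m - 1 candidates; the larger decrease of the harmonic sum is harmless. *)
Lemma connect_und_le (f : pdgraph n -> \bar R) m G :
  (forall H, 0 <= f H)%E ->
  (forall H, inv_und 0 H -> f H <= (potential H)%:E)%E ->
  inv_und m G ->
  (\int[iterate m (@connect_und_step R n) G]_H f H <= (potential G)%:E)%E.
Proof.
move=> f0 fPhi; apply: (@iterate_le _ _ _ inv_und) => {m G} // m G h.
move=> [GD und2 dir0 um] h0 hPhi; rewrite /connect_und_step.
case: ifPn => [u1|].
  by rewrite integral_ret; apply: hPhi; split => //; lia.
rewrite -ltnNge => u1.
have u0 := ltnW u1.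
have sz x : x \in und_stubs G ->
    size (rem x (und_stubs G)) = (size (und_stubs G)).-1.
  by move=> xG; rewrite size_rem.
apply: (pick_pair_le (b := fun x y => potential G + 2 * (light_collision G x y)%:R
    - 2 * (K.+1 * K)%:R * (size (rem x (und_stubs G)))%:R^-1)) => //.
- by move=> x xG; rewrite sz//; lia.
- move=> x y xG yG; apply: le_trans (hPhi _ _) _.
    split=> //=.
    + by move=> v; rewrite raw_degree_join_und.
    + by rewrite und2 andbT /endpoints cards2; case: eqP.
    + have arith (k : nat) : (k <= m.+2 -> k.-2 <= m.+1)%N by lia.
      by rewrite !size_rem//; exact: arith.
  rewrite lee_fin /potential.
  have := load_join_und dir0 xG yG; rewrite -(ler_nat R) natrD.
  have -> : imbalance (join_und x y G) = imbalance G by [].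
  rewrite /= !size_rem//.
  have := um; case: (size _) u1 => [//|[//|k]] _ _ /=.
  rewrite !harmonic_sumS.
  have k0 : 0 <= k.+2%:R^-1 :> R by rewrite invr_ge0.
  have C0 : 0 <= (K.+1 * K)%:R :> R by [].
  have := mulr_ge0 C0 k0.
  set c := (_ * _)%:R; set d := k.+2%:R^-1; set d' := k.+1%:R^-1.
  move: (harmonic_sum _) (harmonic_sum _) => p q.
  nra.
- move=> x xG; apply: sum_step_le; first by rewrite sz//; lia.
  apply: light_collision_count => // v.
  rewrite -GD; apply: leq_trans (raw_degree_size_ge _ _).
  apply: (@leq_trans (stubs_at v (und_stubs G))).
    by rewrite /stubs_at (count_rem_mem _ xG) leq_addl.
  by rewrite -addnA addnC -addnA leq_addr.
Qed.

Definition connect_and_simplify G : graph_law R n :=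
  bind (connect_und R G) (fun G1 => bind (connect_dir R G1) (fun G2 =>
    ret R (make_simple G2))).

Lemma expected_misfits_le G : raw_degree G =1 D ->
  dir_edges G = [::] -> und_edges G = [::] ->
  (\int[connect_and_simplify G]_H (#|misfits D H|%:R)%:E <= (potential G)%:E)%E.
Proof.
move=> GD dir0 und0.
rewrite integral_bind//; apply: connect_und_le => [H|H [HD H2 H0 H1]|].
- by apply: ge0_integral_graph => H'; rewrite lee_fin.
- rewrite integral_bind//.
  under eq_integral do rewrite integral_ret.
  apply: connect_dir_le; split => //; exact: geq_minl.
- by split=> //; rewrite und0.
Qed.

End connecting.

(** * Sums of independent degrees *)

Section iid.
Variables (R : realType) (F : probability degree R).
Local Open Scope ereal_scope.
Implicit Types (psi phi : seq degree -> \bar R).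

Lemma measurable_fun_degree d (V : measurableType d) (f : degree -> V) :
  measurable_fun [set: degree] f.
Proof. by apply: discrete_measurable_fun; exact: measurable_degree. Qed.

Lemma integral_degree_cst (c : R) : \int[F]_d c%:E = c%:E.
Proof.
rewrite (integral_cst F measurableT c%:E).
by rewrite [X in _ * X]probability_setT mule1.
Qed.

Lemma le_integral_degree (f g : degree -> \bar R) : (forall d, 0 <= f d) ->
  (forall d, f d <= g d) -> \int[F]_d f d <= \int[F]_d g d.
Proof.
by move=> f0 fg; apply: ge0_le_integral => // *;
  first [exact: measurable_fun_degree | exact: fg].
Qed.

(** Expectation of a function of m independent degrees with law F, as an iterated
integral that mirrors the successive draws of the model. *)
Fixpoint iid_mean m psi : \bar R :=
  if m is m'.+1 then \int[F]_d iid_mean m' (fun ds => psi (d :: ds))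
  else psi [::].

Lemma iid_mean_ge0 m psi : (forall ds, 0 <= psi ds) -> 0 <= iid_mean m psi.
Proof.
elim: m psi => [|m IH] psi psi0 //=; apply: integral_ge0 => d _.
exact: IH.
Qed.

Lemma le_iid_mean m psi phi : (forall ds, 0 <= psi ds) ->
  (forall ds, size ds = m -> psi ds <= phi ds) ->
  iid_mean m psi <= iid_mean m phi.
Proof.
elim: m psi phi => [|m IH] psi phi psi0 le; first exact: le.
apply: ge0_le_integral => //; first [exact: measurable_fun_degree |
  by move=> d _; exact: iid_mean_ge0 | move=> d _].
by apply: IH => // ds dsm; apply: le; rewrite /= dsm.
Qed.

Lemma iid_meanD m psi phi : (forall ds, 0 <= psi ds) ->
  (forall ds, 0 <= phi ds) ->
  iid_mean m (fun ds => psi ds + phi ds) = iid_mean m psi + iid_mean m phi.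
Proof.
elim: m psi phi => [|m IH] psi phi psi0 phi0 //=.
under eq_integral do rewrite IH//.
rewrite ge0_integralD//; first [exact: measurable_fun_degree |
  by move=> d _; exact: iid_mean_ge0].
Qed.

Lemma iid_meanZ m (c : R) psi : (0 <= c)%R -> (forall ds, 0 <= psi ds) ->
  iid_mean m (fun ds => c%:E * psi ds) = c%:E * iid_mean m psi.
Proof.
move=> c0; elim: m psi => [|m IH] psi psi0 //=.
under eq_integral do rewrite IH//.
rewrite ge0_integralZl//; first [exact: measurable_fun_degree |
  by move=> d _; exact: iid_mean_ge0].
Qed.

Lemma iid_mean_cst m (c : R) : iid_mean m (fun=> c%:E) = c%:E.
Proof.
elim: m => [|m IH] //=; under eq_integral do rewrite IH.
exact: integral_degree_cst.
Qed.

Lemma iid_mean_sum m (g : degree -> R) (c : R) : (forall d, 0 <= g d)%R ->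
  \int[F]_d (g d)%:E = c%:E ->
  iid_mean m (fun ds => (\sum_(d <- ds) g d)%:E) = (m%:R * c)%:E.
Proof.
move=> g0 gc.
have s0 ds : 0 <= (\sum_(d <- ds) g d)%:E.
  by rewrite lee_fin; apply: sumr_ge0.
elim: m => [|m IH] /=; first by rewrite big_nil mul0r.
have E d : iid_mean m (fun ds => (\sum_(e <- d :: ds) g e)%:E) =
    (g d)%:E + (m%:R * c)%:E.
  rewrite (_ : (fun _ => _) = fun ds => (g d)%:E + (\sum_(e <- ds) g e)%:E).
    2: by apply/funext => ds; rewrite big_cons EFinD.
  rewrite iid_meanD// ?iid_mean_cst ?IH// => ds; by rewrite lee_fin.
under eq_integral do rewrite E.
have c0 : (0 <= c)%R.
  by rewrite -lee_fin -gc; apply: integral_ge0 => d _; rewrite lee_fin.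
rewrite ge0_integralD//; first last.
- by move=> d _; rewrite lee_fin mulr_ge0.
- exact: measurable_fun_degree.
- by move=> d _; rewrite lee_fin.
rewrite gc integral_degree_cst.
by rewrite -EFinD -[m.+1]addn1 natrD mulrDl mul1r addrC.
Qed.

Lemma integrable_degree (g : degree -> R) : \int[F]_d `|g d|%:E < +oo ->
  F.-integrable setT (EFin \o g).
Proof. by move=> goo; apply/integrableP; split; [exact: measurable_fun_degree|]. Qed.

Lemma integral_centered (g : degree -> R) (c b : R) :
  F.-integrable setT (EFin \o g) -> \int[F]_d (g d)%:E = 0 ->
  \int[F]_d (c + b * g d)%:E = c%:E.
Proof.
move=> ig g0; under eq_integral do rewrite EFinD EFinM.
have ic : F.-integrable setT (EFin \o cst c).
  exact: finite_measure_integrable_cst.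
rewrite (integralD measurableT ic); last exact: integrableZl.
rewrite integralZl// g0 mule0 adde0; exact: integral_degree_cst.
Qed.

(** The start value a makes the induction go through: after the first draw it
becomes a + g d, and the cross term 2 a (g d) has mean 0. *)
Lemma iid_second_moment m (g : degree -> R) (B a : R) :
  (forall d, `|g d| <= B)%R -> \int[F]_d (g d)%:E = 0 ->
  iid_mean m (fun ds => ((a + \sum_(d <- ds) g d) ^+ 2)%:E) <=
  (a ^+ 2 + m%:R * B ^+ 2)%:E.
Proof.
move=> gB g0; elim: m a => [|m IH] a /=.
  by rewrite big_nil addr0 mul0r addr0.
have ig : F.-integrable setT (EFin \o g).
  apply: integrable_degree; apply: (@le_lt_trans _ _ (\int[F]_d B%:E)).
    by apply: le_integral_degree => d; rewrite lee_fin.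
  by rewrite integral_degree_cst ltry.
rewrite -(@integral_centered g (a ^+ 2 + m.+1%:R * B ^+ 2)%R (2 * a)%R ig g0).
apply: ge0_le_integral => //; first [exact: measurable_fun_degree |
  by move=> d _; apply: iid_mean_ge0 => ds; rewrite lee_fin sqr_ge0 | move=> d _].
rewrite (_ : (fun _ => _) = fun ds => ((a + g d + \sum_(e <- ds) g e) ^+ 2)%:E).
  2: by apply/funext => ds; rewrite big_cons addrA.
apply: (le_trans (IH _)); rewrite lee_fin -[m.+1]addn1 natrD.
have : (g d ^+ 2 <= B ^+ 2)%R.
  by rewrite -[(g d ^+ 2)%R]real_normK ?num_real// lerXn2r// nnegrE
    (le_trans _ (gB d)).
rewrite [((a + g d) ^+ 2)%R]sqrrD; nra.
Qed.

Lemma tail_integral (g : degree -> R) (eps : R) : (forall d, 0 <= g d)%R ->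
  \int[F]_d (g d)%:E < +oo -> (0 < eps)%R ->
  exists M : nat, \int[F]_d (if (M%:R < g d)%R then g d else 0)%:E <= eps%:E.
Proof.
move=> g0 goo eps0.
pose t M d := (if (M%:R < g d)%R then g d else 0)%:E.
have ig : F.-integrable setT (EFin \o g).
  apply: integrable_degree; under eq_integral do rewrite ger0_norm//.
  exact: goo.
have tcvg x : t ^~ x @ \oo --> 0.
  apply: cvg_near_cst; exists (Num.truncn (g x)).+1 => // M /= gM.
  rewrite /t ifN// -leNgt (le_trans (ltW (truncnS_gt _)))//.
  by rewrite ler_nat.
have t0 M d : 0 <= t M d by rewrite /t; case: ifP; rewrite lee_fin.
have tg M d : t M d <= (g d)%:E by rewrite /t; case: ifP; rewrite lee_fin.
have tlim : \int[F]_d t n d @[n --> \oo] --> 0.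
  rewrite -(integral0 F setT).
  apply: (@dominated_cvg _ _ R F setT measurableT t (cst 0) (EFin \o g)) => //.
  - by move=> n; exact: measurable_fun_degree.
  - by move=> n d _; rewrite gee0_abs//=; exact: tg.
have tfin M : \int[F]_d t M d \is a fin_num.
  rewrite ge0_fin_numE; last exact: integral_ge0.
  apply: le_lt_trans goo; apply: ge0_le_integral => //;
    exact: measurable_fun_degree.
move/fine_cvgP : tlim => [_ /cvgr0_norm_le /(_ _ eps0)[M _ tM]].
exists M; rewrite -(fineK (tfin M)) lee_fin.
by apply: le_trans (tM _ (leqnn M)); exact: ler_norm.
Qed.

(** Law of large numbers in mean.  The part of g above a large M has small mean
absolute value.  The truncated part, once centered, is bounded, and its sum is
controlled through its second moment by 2 |x| <= x^2 / (eps n) + eps n. *)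
Lemma iid_lln (g : degree -> R) (eps : R) : \int[F]_d `|g d|%:E < +oo ->
  \int[F]_d (g d)%:E = 0 -> (0 < eps)%R ->
  exists N : nat, forall n, (N <= n)%N ->
    iid_mean n (fun ds => `|\sum_(d <- ds) g d|%:E) <= (eps * n%:R)%:E.
Proof.
move=> goo g0 eps0; have ig := integrable_degree goo.
have eps8 : (0 < eps / 8)%R by rewrite divr_gt0.
have [M tM] := tail_integral (fun d => normr_ge0 (g d)) goo eps8.
pose big d : R := (if M%:R < `|g d| then `|g d| else 0)%R.
have big0 d : (0 <= big d)%R by rewrite /big; case: ifP.
pose small d : R := (if M%:R < `|g d| then 0 else g d)%R.
have smallM d : (`|small d| <= M%:R)%R.
  by rewrite /small; case: ltP => //; rewrite normr0.
have ismall : F.-integrable setT (EFin \o small).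
  apply: integrable_degree; apply: (@le_lt_trans _ _ (\int[F]_d M%:R%:E)).
    by apply: le_integral_degree => d; rewrite lee_fin.
  by rewrite integral_degree_cst ltry.
have ibig : F.-integrable setT (EFin \o big).
  apply: integrable_degree; under eq_integral do rewrite ger0_norm//.
  exact: le_lt_trans tM (ltry _).
pose c := fine (\int[F]_d (small d)%:E).
have cE : \int[F]_d (small d)%:E = c%:E.
  by rewrite fineK//; exact: integrable_fin_num.
have c_small : (`|c| <= eps / 8)%R.
  rewrite -lee_fin; apply: le_trans tM.
  rewrite -abse_EFin -cE -[X in `|X|]sube0 -g0 -integralB//.
  apply: le_trans (le_abse_integral _ _ _) _ => //.
    exact: measurable_fun_degree.
  apply: le_integral_degree => // d; rewrite -EFinB /= lee_fin /small.
  case: ifP => _.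
    by rewrite sub0r normrN.
  by rewrite subrr normr0.
(* The truncation has mean c, which is small because g has mean 0. *)
pose h d : R := (small d - c)%R.
pose B : R := (M%:R + eps)%R.
have hB d : (`|h d| <= B)%R.
  apply: le_trans (ler_normB _ _) _; apply: lerD => //.
  by apply: (le_trans c_small); lra.
have h0 : \int[F]_d (h d)%:E = 0.
  under eq_integral do rewrite EFinB.
  rewrite integralB//; last exact: finite_measure_integrable_cst.
  by rewrite cE integral_degree_cst subee.
pose b := fine (\int[F]_d (big d)%:E).
have bE : \int[F]_d (big d)%:E = b%:E.
  by rewrite fineK//; exact: integrable_fin_num.
have b_small : (b <= eps / 8)%R by rewrite -lee_fin -bE.
exists (Num.truncn (2 * B ^+ 2 / eps ^+ 2)).+1 => n Nn.
have n_large : (2 * B ^+ 2 / eps ^+ 2 <= n%:R)%R.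
  by apply: le_trans (ltW (truncnS_gt _)) _; rewrite ler_nat.
have n0 : (0 < n%:R :> R)%R by rewrite ltr0n; exact: leq_trans Nn.
pose a : R := (2 * (eps * n%:R))^-1%R.
have a0 : (0 < a)%R by rewrite invr_gt0 mulr_gt0// mulr_gt0.
pose k : R := (eps * n%:R / 2 + n%:R * (eps / 8))%R.
have k0 : (0 <= k)%R by rewrite addr_ge0// !mulr_ge0// ?ltW.
have ptw ds : size ds = n -> `|\sum_(d <- ds) g d|%:E <=
    a%:E * ((0 + \sum_(d <- ds) h d) ^+ 2)%:E +
    (k%:E + (\sum_(d <- ds) big d)%:E).
  move=> dsn; rewrite -EFinM -!EFinD lee_fin add0r.
  have -> : (\sum_(d <- ds) g d =
      \sum_(d <- ds) h d + n%:R * c + \sum_(d <- ds) (g d - small d))%R.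
    rewrite !sumrB big_const_seq count_predT iter_addr_0 dsn mulr_natl; lra.
  have t1 : (`|n%:R * c| <= n%:R * (eps / 8))%R.
    by rewrite normrM ger0_norm// ler_pM2l.
  have t2 : (`|\sum_(d <- ds) (g d - small d)| <= \sum_(d <- ds) big d)%R.
    apply: le_trans (ler_norm_sum _ _ _) _; apply: ler_sum => d _.
    by rewrite /big /small; case: ifP => _; rewrite ?subr0// subrr normr0.
  have t3 : (`|\sum_(d <- ds) h d| <=
      a * (\sum_(d <- ds) h d) ^+ 2 + eps * n%:R / 2)%R.
    set x := (\sum_(d <- ds) h d)%R; rewrite -[(x ^+ 2)%R]real_normK ?num_real//.
    have e0 : (0 < eps * n%:R)%R by rewrite mulr_gt0.
    have -> : (a * `|x| ^+ 2 + eps * n%:R / 2 =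
      `|x| + a * (`|x| - eps * n%:R) ^+ 2)%R by rewrite /a; field; rewrite !gt_eqF.
    by rewrite lerDl mulr_ge0 ?sqr_ge0// ltW.
  apply: (le_trans (ler_normD _ _)); apply: (le_trans (lerD (ler_normD _ _) t2)).
  by rewrite /k addrA lerD2r addrA; apply: lerD.
have pos1 ds : 0 <= ((0 + \sum_(d <- ds) h d) ^+ 2)%:E :> \bar R.
  by rewrite lee_fin sqr_ge0.
have pos2 ds : 0 <= (\sum_(d <- ds) big d)%:E :> \bar R.
  by rewrite lee_fin sumr_ge0.
apply: le_trans (le_iid_mean _ ptw) _; first by move=> ds; rewrite lee_fin.
rewrite iid_meanD; first last.
- by move=> ds; rewrite adde_ge0// lee_fin.
- by move=> ds; rewrite mule_ge0// lee_fin ltW.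
rewrite iid_meanZ//; last exact: ltW.
rewrite iid_meanD// iid_mean_cst (iid_mean_sum _ big0 bE).
apply: (@le_trans _ _ (a%:E * (0 ^+ 2 + n%:R * B ^+ 2)%:E + (k%:E + (n%:R * b)%:E))).
  by apply: leeD => //; apply: lee_wpmul2l;
    [rewrite lee_fin ltW|exact: iid_second_moment].
rewrite -EFinM -!EFinD lee_fin expr0n /= add0r.
have -> : (a * (n%:R * B ^+ 2) = B ^+ 2 / (2 * eps))%R.
  by rewrite /a; field; rewrite !gt_eqF.
have t1 : (B ^+ 2 / (2 * eps) <= eps * n%:R / 4)%R.
  have -> : (B ^+ 2 / (2 * eps) = eps * (2 * B ^+ 2 / eps ^+ 2) / 4)%R.
    by field; rewrite gt_eqF.
  by rewrite ler_pM2r// ler_pM2l.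
have t2 : (n%:R * b <= n%:R * (eps / 8))%R by rewrite ler_pM2l.
rewrite /k; lra.
Qed.

End iid.

(** * The graph before connection *)

Section initial_graph.
Variables (R : realType) (F : probability degree R) (n : nat).
Implicit Types (G : pdgraph n) (D : 'I_n -> degree) (ds : seq degree).

Fixpoint give_degrees (vs : seq 'I_n) ds G : pdgraph n :=
  match vs, ds with
  | r :: vs', d :: ds' => give_degrees vs' ds' (add_stubs r d G)
  | _, _ => G
  end.

Lemma integral_attach_stubs vs G (f : pdgraph n -> \bar R) :
  (forall H, 0 <= f H)%E ->
  (\int[attach_stubs F vs G]_H f H =
   iid_mean F (size vs) (fun ds => f (give_degrees vs ds G)))%E.
Proof.
move=> f0; elim: vs G => [|r vs IH] G; first by rewrite /= integral_ret.
rewrite [attach_stubs _ _ _]/= integral_then_law//.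
by apply: eq_integral => d _; exact: IH.
Qed.

Lemma count_new_stubs (p : pred 'I_n) r m :
  count (fun x => p x.1) (new_stubs r m) = (p r * m)%N.
Proof.
rewrite /new_stubs count_map (eq_count (a2 := fun=> p r))//.
by case: (p r); rewrite ?count_predT ?count_pred0 ?size_iota ?mul1n.
Qed.

Lemma give_degrees_edges vs ds G :
  dir_edges (give_degrees vs ds G) = dir_edges G /\
  und_edges (give_degrees vs ds G) = und_edges G.
Proof.
elim: vs ds G => [|r vs IH] [|d ds] G //=.
by have := IH ds (add_stubs r d G).
Qed.

Lemma count_give_degrees (p : pred 'I_n) vs D G :
  let q := fun x : stub n => p x.1 in let H := give_degrees vs (map D vs) G in
  [/\ count q (in_stubs H) =
        (count q (in_stubs G) + \sum_(v <- vs) p v * deg_in (D v))%N,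
      count q (out_stubs H) =
        (count q (out_stubs G) + \sum_(v <- vs) p v * deg_out (D v))%N &
      count q (und_stubs H) =
        (count q (und_stubs G) + \sum_(v <- vs) p v * deg_und (D v))%N].
Proof.
elim: vs G => [|r vs IH] G /=; first by rewrite !big_nil !addn0.
have [-> -> ->] := IH (add_stubs r (D r) G).
by rewrite /= !count_cat !count_new_stubs !big_cons !addnA.
Qed.

Definition initial_graph ds := give_degrees (enum 'I_n) ds (empty_graph n).

(** Vertices draw their degrees in increasing order, so that the degree of v is
the entry number v; the default value is never reached on lists of length n. *)
Definition listed_degree ds (v : 'I_n) : degree := nth (0, 0, 0)%N ds v.

Lemma map_listed_degree ds : size ds = n -> map (listed_degree ds) (enum 'I_n) = ds.
Proof.
move=> dsn; rewrite (_ : listed_degree ds = nth (0, 0, 0)%N ds \o val)//.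
by rewrite map_comp val_enum_ord -dsn map_nth_iota0// take_size.
Qed.

Lemma sum_listed_degree (A : nmodType) (g : degree -> A) ds : size ds = n ->
  \sum_(v < n) g (listed_degree ds v) = \sum_(d <- ds) g d.
Proof. by move=> dsn; rewrite -[in RHS](map_listed_degree dsn) big_map big_enum. Qed.

Lemma count_initial_graph (p : pred 'I_n) ds : size ds = n ->
  let D := listed_degree ds in let q := fun x : stub n => p x.1 in
  [/\ count q (in_stubs (initial_graph ds)) = (\sum_v p v * deg_in (D v))%N,
      count q (out_stubs (initial_graph ds)) = (\sum_v p v * deg_out (D v))%N &
      count q (und_stubs (initial_graph ds)) = (\sum_v p v * deg_und (D v))%N].
Proof.
move=> dsn D q; rewrite /initial_graph -(map_listed_degree dsn) -/D.
have [-> -> ->] := count_give_degrees p (enum 'I_n) D (empty_graph n).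
by rewrite /= !add0n !big_enum.
Qed.

Lemma initial_graph_edges ds :
  dir_edges (initial_graph ds) = [::] /\ und_edges (initial_graph ds) = [::].
Proof. exact: give_degrees_edges. Qed.

Lemma raw_degree_initial_graph ds : size ds = n ->
  raw_degree (initial_graph ds) =1 listed_degree ds.
Proof.
move=> dsn v; have [dir0 und0] := initial_graph_edges ds.
have [i o u] := count_initial_graph (pred1 v) dsn.
rewrite /raw_degree dir0 und0 big_nil /= !addn0 /stubs_at i o u.
have sel (g : 'I_n -> nat) : (\sum_w (w == v) * g w)%N = g v.
  rewrite (bigD1 v)//= eqxx mul1n big1 ?addn0// => w wv.
  by rewrite (negPf wv).
by rewrite !sel; case: (listed_degree _ _) => [[]].
Qed.

Lemma size_initial_graph ds : size ds = n ->
  [/\ size (in_stubs (initial_graph ds)) = (\sum_(d <- ds) deg_in d)%N,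
      size (out_stubs (initial_graph ds)) = (\sum_(d <- ds) deg_out d)%N &
      size (und_stubs (initial_graph ds)) = (\sum_(d <- ds) deg_und d)%N].
Proof.
move=> dsn; have [i o u] := count_initial_graph predT dsn.
have sumE g := @sum_listed_degree nat g ds dsn.
rewrite -!(count_predT (_ (initial_graph ds))) i o u -!sumE.
by split; apply: eq_bigr => v _; rewrite mul1n.
Qed.

(** Heavy vertices contribute all of their stubs to the load. *)
Definition excess K d : nat := (K < degree_size d)%N * degree_size d.

Lemma load_initial_graph K ds : size ds = n ->
  load (listed_degree ds) K (initial_graph ds) = (\sum_(d <- ds) excess K d)%N.
Proof.
move=> dsn; have [dir0 und0] := initial_graph_edges ds.
have [i o u] := count_initial_graph
  (fun v => K < degree_size (listed_degree ds v))%N dsn.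
rewrite /load /links dir0 und0 /= add0n /heavy i o u.
rewrite -(@sum_listed_degree nat (excess K) ds dsn) -!big_split.
by apply: eq_bigr => v _; rewrite /= -!mulnDr.
Qed.

End initial_graph.

(** * Convergence of the degree distribution *)

Section harmonic.
Variable R : realType.

(** Only the terms 1/i with i < 1/eps exceed eps. *)
Lemma harmonic_sum_sublinear (eps : R) : 0 < eps ->
  exists2 c : R, 0 <= c & forall m, harmonic_sum R m <= eps * m%:R + c.
Proof.
move=> eps0; pose M := (Num.truncn eps^-1).+1.
exists (harmonic_sum R M); first exact: harmonic_sum_ge0.
elim=> [|m IH]; first by rewrite /harmonic_sum big_ord0 mulr0 add0r harmonic_sum_ge0.
have [mM|Mm] := leqP m.+1 M.
  rewrite (@le_trans _ _ (harmonic_sum R M))//; last first.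
    by rewrite lerDr mulr_ge0// ltW.
  rewrite -(subnKC mM); elim: (M - m.+1)%N => [|k IHk]; first by rewrite addn0.
  by rewrite addnS [leRHS]harmonic_sumS (le_trans IHk)// lerDl invr_ge0.
rewrite harmonic_sumS.
have small : m.+1%:R^-1 <= eps.
  rewrite -[leRHS]invrK lef_pV2 ?posrE ?invr_gt0//.
  apply: le_trans (ltW (truncnS_gt _)) _.
  by rewrite ler_nat; exact: ltnW.
by rewrite -[in leRHS]addn1 natrD mulrDr mulr1 addrAC; apply: lerD.
Qed.

End harmonic.

Lemma markov_graph (R : realType) (n : nat) (P : graph_law R n)
    (X : pdgraph n -> R) (eps : R) : 0 < eps ->
  (forall G, 0 <= X G) ->
  (eps%:E * P [set G | (eps < X G)%R] <= \int[P]_G (X G)%:E)%E.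
Proof.
move=> eps0 X0; set A := [set G | _].
have epsE0 : (0 <= eps%:E)%E by rewrite lee_fin ltW.
apply: (@le_trans _ _ (\int[P]_G (eps%:E * (\1_A G)%:E))%E).
  rewrite ge0_integralZl//; try exact: measurable_fun_graph.
    by rewrite integral_indic// setIT.
apply: le_integral_graph => G; first by rewrite mule_ge0// lee_fin.
rewrite -EFinM lee_fin indicE; case: (boolP (G \in A)); last by rewrite mulr0.
by rewrite inE /A /= mulr1 => /ltW.
Qed.

Section convergence.
Variables (R : realType) (F : probability degree R).

Lemma integral_config_model n (f : pdgraph n -> \bar R) :
  (forall H, 0 <= f H)%E ->
  (\int[config_model n F]_H f H = iid_mean F n
    (fun ds => \int[connect_and_simplify R (initial_graph n ds)]_H f H))%E.
Proof.
move=> f0; rewrite integral_bind// integral_attach_stubs.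
  by rewrite size_enum_ord.
by move=> H; exact: ge0_integral_graph.
Qed.

(** Changing the degree of one vertex changes N_d by at most one. *)
Lemma frac_degree_dist n (d : degree) (p : R) (ds : seq degree) (H : pdgraph n) :
  (0 < n)%N -> size ds = n ->
  `|frac_degree d H - p| <= n%:R^-1 *
    (`|\sum_(e <- ds) ((e == d)%:R - p)| + #|misfits (listed_degree ds) H|%:R).
Proof.
move=> n0 dsn; have n0' : (0 < n%:R :> R) by rewrite ltr0n.
have -> : frac_degree d H - p =
    n%:R^-1 * \sum_(v < n) ((vertex_degree H v == d)%:R - p) :> R.
  rewrite sumrB sumr_const card_ord -[p *+ n]mulr_natl mulrBr mulKf ?gt_eqF//.
  rewrite /frac_degree /num_degree -natr_sum mulrC; congr (_ * _%:R - _).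
  by rewrite -sum1dep_card big_mkcond; apply: eq_bigr => v _; case: (_ == _).
rewrite normrM ger0_norm ?invr_ge0 ?ler0n// ler_pM2l ?invr_gt0//.
rewrite -(@sum_listed_degree n _ (fun e => (e == d)%:R - p) ds dsn).
set D := listed_degree ds.
have -> : #|misfits D H|%:R = \sum_(v < n) (vertex_degree H v != D v)%:R :> R.
  by rewrite /misfits -natr_sum -sum1dep_card big_mkcond; congr _%:R.
rewrite [X in `|X| <= _](_ : _ = \sum_(v < n) ((D v == d)%:R - p) +
   \sum_(v < n) ((vertex_degree H v == d)%:R - (D v == d)%:R)); last first.
  by rewrite -big_split; apply: eq_bigr => v _ /=; lra.
apply: le_trans (ler_normD _ _) _; rewrite lerD2l.
apply: le_trans (ler_norm_sum _ _ _) _; apply: ler_sum => v _.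
have [->|] := eqVneq (vertex_degree H v) (D v); first by rewrite subrr normr0.
case: (_ == d); case: (_ == d) => _ /=;
  by rewrite ?subrr ?normr0 ?subr0 ?sub0r ?normrN ?normr1.
Qed.

Hypotheses (mu_in_fin : ('E_F[fun d => (deg_in d)%:R] < +oo)%E)
  (mu_out_fin : ('E_F[fun d => (deg_out d)%:R] < +oo)%E)
  (mu_und_fin : ('E_F[fun d => (deg_und d)%:R] < +oo)%E)
  (mu_in_out : ('E_F[fun d => (deg_in d)%:R] =
                'E_F[fun d => (deg_out d)%:R])%E).


Lemma imbalanceE n ds : size ds = n ->
  (imbalance (initial_graph n ds))%:R =
  `|\sum_(e <- ds) ((deg_in e)%:R - (deg_out e)%:R)| :> R.
Proof.
move=> dsn; have [i o _] := size_initial_graph dsn.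
rewrite /imbalance i o sumrB -!natr_sum.
move: (\sum_(e <- ds) deg_in e)%N (\sum_(e <- ds) deg_out e)%N => a b.
rewrite natrD; have [ab|/ltnW ab] := leqP a b.
  rewrite (natrB _ ab) (eqP (_ : a - b == 0)%N) ?subn_eq0// add0r.
  by rewrite distrC ger0_norm// subr_ge0 ler_nat.
rewrite (natrB _ ab) (eqP (_ : b - a == 0)%N) ?subn_eq0// addr0.
by rewrite ger0_norm// subr_ge0 ler_nat.
Qed.

Lemma potential_le K n ds (delta c : R) : size ds = n ->
  (forall m, harmonic_sum R m <= delta * m%:R + c) -> 0 <= delta ->
  potential R (listed_degree ds) K (initial_graph n ds) <=
  `|\sum_(e <- ds) ((deg_in e)%:R - (deg_out e)%:R)| +
  (\sum_(e <- ds) (2 * (excess K e)%:R +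
     2 * (K.+1 * K)%:R * delta * (degree_size e)%:R) +
   (4 * (K.+1 * K)%:R * c + 1)).
Proof.
move=> dsn hc delta0; have [_ o u] := size_initial_graph dsn.
rewrite /potential (load_initial_graph _ dsn) (imbalanceE dsn) o u.
set out := (\sum_(d <- ds) deg_out d)%N; set und := (\sum_(d <- ds) deg_und d)%N.
set I := `|_|; rewrite big_split /= -!mulr_sumr -!natr_sum.
set S := (\sum_(d <- ds) degree_size d)%N.
have outS : (out + und <= S)%N.
  by rewrite /out /und -big_split; apply: leq_sum => e _;
    rewrite /degree_size /= -addnA leq_addl.
have C0 : 0 <= 2 * (K.+1 * K)%:R :> R by rewrite mulr_ge0.
have hle : harmonic_sum R out + harmonic_sum R und <= delta * S%:R + 2 * c.
  apply: le_trans (lerD (hc _) (hc _)) _.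
  have : delta * (out%:R + und%:R) <= delta * S%:R.
    by rewrite ler_wpM2l// -natrD ler_nat.
  by rewrite mulrDr; lra.
have := ler_wpM2l C0 hle.
set C := (K.+1 * K)%:R; set E := (\sum_(d <- ds) _)%:R.
move: (harmonic_sum _ _ + harmonic_sum _ _) => h; nra.
Qed.

(** The order of choices matters: first K, which makes the mean excess small, then
the slope delta of the linear bound on harmonic sums, which has to beat the
factor K(K+1), and n last. *)
Lemma expected_distance d (eps : R) : 0 < eps ->
  exists N : nat, forall n, (N <= n)%N ->
  (\int[config_model n F]_H (`|frac_degree d H - point_prob F d|)%:E <= eps%:E)%E.
Proof.
move: mu_in_fin mu_out_fin mu_und_fin mu_in_out; rewrite unlock.
move=> in_fin out_fin und_fin in_out eps0; set p := point_prob F d.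
pose e := eps / 8; have e0 : 0 < e by rewrite divr_gt0.
have mF (f : degree -> \bar R) : measurable_fun [set: degree] f.
  exact: measurable_fun_degree.
pose g1 (x : degree) : R := (x == d)%:R - p.
have [N1 HN1] : exists N : nat, forall n, (N <= n)%N ->
    (iid_mean F n (fun ds => `|\sum_(x <- ds) g1 x|%:E) <= (e * n%:R)%:E)%E.
  have ind_int : F.-integrable setT (fun x => ((x == d)%:R : R)%:E).
    apply: integrable_degree; apply: (@le_lt_trans _ _ (\int[F]_x 1%:E)%E).
      apply: le_integral_degree => x; rewrite lee_fin//.
      by case: (x == d); rewrite ?normr1 ?normr0.
    by rewrite integral_degree_cst ltry.
  have cst_int : F.-integrable setT (EFin \o cst p).
    exact: finite_measure_integrable_cst.
  apply: iid_lln => //.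
    apply: (@le_lt_trans _ _ (\int[F]_x (1 + `|p|)%:E)%E).
      apply: le_integral_degree => x; rewrite lee_fin//.
      apply: le_trans (ler_normB _ _) _; rewrite lerD2r.
      by case: (x == d); rewrite ?normr1 ?normr0.
    by rewrite integral_degree_cst ltry.
  under eq_integral do rewrite EFinB.
  rewrite integralB// integral_degree_cst.
  have -> : (fun x => ((x == d)%:R : R)%:E) = (fun x => (\1_[set d] x)%:E).
    apply/funext => x; rewrite indicE; do 3 congr (_ _).
    by apply/idP/idP => [/eqP/mem_set|/set_mem/eqP].
  rewrite integral_indic//; last exact: measurable_degree.
  rewrite setIT /p /point_prob fineK ?subee//; apply: fin_num_measure;
    exact: measurable_degree.
pose g2 (x : degree) : R := (deg_in x)%:R - (deg_out x)%:R.
have in_int : F.-integrable setT (EFin \o (fun x => (deg_in x)%:R : R)).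
  by apply: integrable_degree; under eq_integral do rewrite normr_nat.
have out_int : F.-integrable setT (EFin \o (fun x => (deg_out x)%:R : R)).
  by apply: integrable_degree; under eq_integral do rewrite normr_nat.
have und_int : F.-integrable setT (EFin \o (fun x => (deg_und x)%:R : R)).
  by apply: integrable_degree; under eq_integral do rewrite normr_nat.
have [N2 HN2] : exists N : nat, forall n, (N <= n)%N ->
    (iid_mean F n (fun ds => `|\sum_(x <- ds) g2 x|%:E) <= (e * n%:R)%:E)%E.
  apply: iid_lln => //.
    by have /integrableP[] := integrableB measurableT in_int out_int.
  under eq_integral do rewrite EFinB.
  rewrite integralB//= -in_out subee//; exact: integrable_fin_num.
pose sz (x : degree) : R := (degree_size x)%:R.
have sz_int : F.-integrable setT (EFin \o sz).
  rewrite (_ : EFin \o sz = (fun x => (deg_in x)%:R%:E + (deg_out x)%:R%:E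
    + (deg_und x)%:R%:E)%E).
    exact: integrableD (integrableD _ in_int out_int) und_int.
  by apply/funext => x; rewrite /sz /= /degree_size !natrD.
have sz_fin : (\int[F]_x (sz x)%:E)%E \is a fin_num by exact: integrable_fin_num.
pose s := fine (\int[F]_x (sz x)%:E)%E.
have sE : (\int[F]_x (sz x)%:E)%E = s%:E by rewrite fineK.
have s0 : 0 <= s by apply: fine_ge0; apply: integral_ge0 => x _; rewrite lee_fin.
have sz_lty : (\int[F]_x (sz x)%:E < +oo)%E by rewrite sE ltry.
have [K tK] := tail_integral (fun x => ler0n R (degree_size x)) sz_lty e0.
pose C : R := (K.+1 * K)%:R; have C0 : 0 <= C by [].
have Cs0 : 0 < 2 * C * s + 1 by rewrite ltr_wpDl// !mulr_ge0.
pose delta := e / (2 * C * s + 1).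
have delta0 : 0 < delta by rewrite divr_gt0.
have delta_le : 2 * C * delta * s <= e.
  have -> : 2 * C * delta * s = e * ((2 * C * s) / (2 * C * s + 1)).
    rewrite /delta; move: (2 * C * s + 1) Cs0 => q q0; field; exact: lt0r_neq0.
  apply: ler_piMr; first exact: ltW.
  by rewrite ler_pdivrMr// mul1r lerDl.
have [c c0 hc] := harmonic_sum_sublinear delta0.
pose w (x : degree) : R := 2 * (excess K x)%:R + 2 * C * delta * sz x.
have Cd0 : 0 <= 2 * C * delta by rewrite mulr_ge0 ?(ltW delta0)// mulr_ge0.
have sz0 x : 0 <= sz x by exact: ler0n.
have w0 x : 0 <= w x.
  by apply: addr_ge0; apply: mulr_ge0.
have excessE x : (excess K x)%:R = if K%:R < sz x then sz x else 0 :> R.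
  by rewrite /excess /sz ltr_nat; case: ifP => _; rewrite ?mul1n.
have w_le : (\int[F]_x (w x)%:E <= (3 * e)%:E)%E.
  under eq_integral do rewrite EFinD (EFinM 2) (EFinM (2 * C * delta)).
  rewrite ge0_integralD//; try by move=> x _; rewrite -EFinM lee_fin mulr_ge0.
  rewrite !ge0_integralZl//; try by move=> x _; rewrite lee_fin.
  rewrite sE; under eq_integral do rewrite excessE.
  apply: (@le_trans _ _ (2%:E * e%:E + (2 * C * delta)%:E * s%:E)%E).
    by apply: leeD => //; apply: lee_wpmul2l; rewrite ?lee_fin.
  by rewrite -!EFinM -EFinD lee_fin; lra.
have wE : (\int[F]_x (w x)%:E)%E = (fine (\int[F]_x (w x)%:E)%E)%:E.
  rewrite fineK// ge0_fin_numE; first exact: le_lt_trans w_le (ltry _).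
  by apply: integral_ge0 => x _; rewrite lee_fin.
move: (fine _) wE => v wE; rewrite wE lee_fin in w_le.
pose k : R := 4 * C * c + 1; have k0 : 0 <= k by rewrite addr_ge0// !mulr_ge0.
exists (maxn (maxn N1 N2) (Num.truncn (k / e)).+1) => n.
rewrite !geq_max => /andP[/andP[n1 n2] n3].
have n_gt0 : (0 < n)%N by exact: leq_trans n3.
have n0 : 0 < n%:R :> R by rewrite ltr0n.
have kn : k <= e * n%:R.
  rewrite mulrC -ler_pdivrMr//; apply: le_trans (ltW (truncnS_gt _)) _.
  by rewrite ler_nat.
rewrite integral_config_model; last by move=> H; rewrite lee_fin.
pose A ds := (`|\sum_(x <- ds) g1 x|)%:E : \bar R.
pose B ds := (`|\sum_(x <- ds) g2 x|)%:E : \bar R.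
pose W ds := (\sum_(x <- ds) w x)%:E : \bar R.
have A0 ds : (0 <= A ds)%E by rewrite lee_fin.
have B0 ds : (0 <= B ds)%E by rewrite lee_fin.
have W0 ds : (0 <= W ds)%E by rewrite lee_fin sumr_ge0.
have kE0 : (0 <= k%:E)%E by rewrite lee_fin.
have ninv0 : 0 <= n%:R^-1 :> R by rewrite invr_ge0.
have bound ds : size ds = n ->
    (\int[connect_and_simplify R (initial_graph n ds)]_H
       (`|frac_degree d H - p|)%:E <=
     n%:R^-1%:E * (A ds + (B ds + (W ds + k%:E))))%E.
  move=> dsn; have [dir0 und0] := initial_graph_edges n ds.
  apply: (@le_trans _ _ (\int[connect_and_simplify R (initial_graph n ds)]_H
      (n%:R^-1%:E * (A ds + (#|misfits (listed_degree ds) H|%:R)%:E)))%E).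
    apply: le_integral_graph => H; first by rewrite lee_fin.
    by rewrite -EFinD -EFinM lee_fin; exact: frac_degree_dist.
  rewrite ge0_integralZl//; try by move=> H _; rewrite adde_ge0// lee_fin.
  apply: lee_wpmul2l; first by rewrite lee_fin.
  rewrite ge0_integralD//; try by move=> H _; rewrite lee_fin.
  apply: leeD.
    rewrite (integral_cst _ measurableT (A ds)).
    by rewrite [X in (_ * X)%E]probability_setT mule1.
  have := expected_misfits_le R K (raw_degree_initial_graph dsn) dir0 und0.
  move=> /le_trans; apply; rewrite -!EFinD lee_fin.
  by apply: potential_le => //; exact: ltW.
apply: (@le_trans _ _ (iid_mean F n (fun ds =>
    n%:R^-1%:E * (A ds + (B ds + (W ds + k%:E)))))%E).
  apply: le_iid_mean => // ds.
  by apply: ge0_integral_graph => H; rewrite lee_fin.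
rewrite iid_meanZ//; last by move=> ds; rewrite !adde_ge0.
rewrite iid_meanD//; last by move=> ds; rewrite !adde_ge0.
rewrite iid_meanD//; last by move=> ds; rewrite !adde_ge0.
rewrite iid_meanD// iid_mean_cst (iid_mean_sum _ w0 wE).
apply: (@le_trans _ _ (n%:R^-1%:E * ((e * n%:R)%:E + ((e * n%:R)%:E +
    ((n%:R * v)%:E + k%:E))))%E).
  apply: lee_wpmul2l; first by rewrite lee_fin.
  by apply: leeD; [exact: HN1|apply: leeD => //; exact: HN2].
rewrite -!EFinD -EFinM lee_fin mulrC ler_pdivrMr//.
have vn : n%:R * v <= n%:R * (3 * e) by rewrite ler_pM2l.
have -> : eps = 8 * e by rewrite /e; field.
have en : 0 < e * n%:R by rewrite mulr_gt0.
nra.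
Qed.

Lemma mean_frac_cvg d : mean_frac F n d @[n --> \oo] --> point_prob F d.
Proof.
apply/cvgrPdist_le => eps eps0; have [N HN] := expected_distance d eps0.
exists N => // n /= Nn; rewrite distrC; set p := point_prob F d.
rewrite /mean_frac unlock.
have frac1 (H : pdgraph n) : 0 <= (frac_degree d H : R) <= 1.
  rewrite /frac_degree divr_ge0//=; case: (posnP n) => [n0|n0].
    by rewrite [X in _ / X](_ : _ = 0) ?invr0 ?mulr0// n0.
  rewrite ler_pdivrMr ?ltr0n// mul1r ler_nat.
  by rewrite -[leqRHS]card_ord max_card.
have cst_int (c : R) : (\int[config_model n F]_H c%:E = c%:E)%E.
  rewrite (integral_cst (config_model n F) measurableT c%:E).
  by rewrite [X in (_ * X)%E]probability_setT mule1.
have ifrac : (config_model n F).-integrable setT (EFin \o frac_degree d).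
  apply/integrableP; split; first exact: measurable_fun_graph.
  apply: (@le_lt_trans _ _ (\int[config_model n F]_H 1%:E)%E); last first.
    by rewrite cst_int ltry.
  apply: le_integral_graph => H //=; rewrite lee_fin.
  by have /andP[? ?] := frac1 H; rewrite ger0_norm.
rewrite -lee_fin; apply: le_trans (HN n Nn).
rewrite -abse_EFin EFinB fineK; last exact: integrable_fin_num.
rewrite -[X in (`|_ - X|)%E]cst_int -integralB//; last first.
  exact: finite_measure_integrable_cst.
apply: le_trans (le_abse_integral _ _ _) _ => //; exact: measurable_fun_graph.
Qed.

(** Markov's inequality applied to the distance in mean. *)
Lemma frac_degree_cvg_in_probability d :
  cvg_in_probability (fun n => config_model n F)
    (fun n G => frac_degree d G) (point_prob F d).
Proof.
move=> eps eps0; apply/fine_cvgP; split.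
  by near=> n; exact: fin_num_measure.
apply/cvgrPdist_le => del del0.
have [N HN] := expected_distance d (mulr_gt0 eps0 del0).
exists N => // n /= Nn; rewrite distrC subr0.
set A := [set w | _]; rewrite ger0_norm ?fine_ge0//.
rewrite -(ler_pM2l eps0); rewrite -lee_fin; apply: le_trans (HN n Nn).
rewrite EFinM fineK; last exact: fin_num_measure.
by apply: markov_graph.
Unshelve. all: by end_near.
Qed.

End convergence.

Theorem theorem1 (R : realType) (F : probability degree R)
  (mu_in_fin : ('E_F[fun d => (deg_in d)%:R] < +oo)%E)
  (mu_out_fin : ('E_F[fun d => (deg_out d)%:R] < +oo)%E)
  (mu_und_fin : ('E_F[fun d => (deg_und d)%:R] < +oo)%E)
  (mu_in_out : ('E_F[fun d => (deg_in d)%:R] =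
                'E_F[fun d => (deg_out d)%:R])%E) :
  (forall d : degree, mean_frac F n d @[n --> \oo] --> point_prob F d) /\
  (forall d : degree,
     cvg_in_probability (fun n => config_model n F)
       (fun n G => frac_degree d G) (point_prob F d)).
Proof.
split=> d; first exact: mean_frac_cvg.
exact: frac_degree_cvg_in_probability.
Qed.
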